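(* Let $\mathcal{G}=(\mathcal{N},(\Omega^p)_{p\in\mathcal{N}},(\mathcal{U}^p)_{p\in\mathcal{N}})$ be a concave game with pseudo-gradient $U$, and suppose that for every $p\in\mathcal{N}$, $\mathcal{U}^p$ satisfies the following when $\Omega^p$ is non-compact: $-\mathcal{U}^p$ is coercive in $x^p$, i.e. $\lim_{\|x^p\|\to\infty}-\mathcal{U}^p(x^p;x^{-p})=+\infty$ for all $x^{-p}\in\Omega^{-p}$. For each $p\in\mathcal{N}$ let $\vartheta^p:\mathbb{R}^{n_p}\to\mathbb{R}\cup\{\infty\}$ be a closed, proper, convex function with $\operatorname{dom}(\vartheta^p)=\Omega^p$ non-empty, closed and convex, and suppose that $\vartheta^p$ is Legendre with $\operatorname{int}(\operatorname{dom}(\vartheta^p))\neq\varnothing$. Let $\epsilon>0$, $\gamma>0$, and let $C=(C^p)_{p\in\mathcal{N}}$ be the mirror map induced by $\psi^p=\epsilon\vartheta^p$, $p\in\mathcal N$. Let the players' dynamics be the discounted mirror descent dynamics (DMD) $$\dot z^p=\gamma(-z^p+u^p),\qquad x^p=C^p(z^p),\qquad u^p=\nabla_{x^p}\mathcal{U}^p(x^p;x^{-p}),\qquad p\in\mathcal{N}.$$ Assume that $U\circ C$ has a finite number of fixed points $\overline z$, all isolated. If $-U$ is monotone, or strictly monotone, or $\eta$-strongly monotone for some $\eta>0$, then for any $\epsilon>0$ the auxiliary variables $z(t)=(z^p(t))_{p\in\mathcal{N}}$ converge, as $t\to\infty$, to a rest point $\overline z$ of the dynamics, while the players' actions $x(t)=(x^p(t))_{p\in\mathcal{N}}$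 converge to $\overline x=C(\overline z)$, a perturbed Nash equilibrium of $\mathcal{G}$.
   Context: A game $\mathcal{G}=(\mathcal{N},(\Omega^p)_{p\in\mathcal N},(\mathcal{U}^p)_{p\in\mathcal N})$ has player set $\mathcal{N}=\{1,\dots,N\}$, action sets $\Omega^p\subseteq\mathbb{R}^{n_p}$, $\Omega=\prod_p\Omega^p\subseteq\mathbb{R}^n$, $n=\sum_p n_p$, and payoff functions $\mathcal{U}^p:\Omega\to\mathbb{R}$. One writes $x=(x^p;x^{-p})$, where $x^{-p}\in\Omega^{-p}$ is the action profile of all players except $p$. $\mathcal{G}$ is a concave game if for all $p$: $\Omega^p$ is non-empty, closed and convex; $\mathcal{U}^p$ is jointly continuous in $x$; and $\mathcal{U}^p(x^p;x^{-p})$ is concave and continuously differentiable in $x^p$ for all $x^{-p}\in\Omega^{-p}$. The pseudo-gradient is $U:\Omega\to\mathbb{R}^n$, $U(x)=(U^p(x))_{p\in\mathcal N}$, $U^p(x)=\nabla_{x^p}\mathcal{U}^p(x^p;x^{-p})$; it is taken to be continuous. For all $x,x'\in\Omega$: $-U$ is monotone if $-(U(x)-U(x'))^\top(x-x')\ge 0$; strictly monotone if this is $>0$ whenever $x\neq x'$; $\eta$-strongly monotone if it is $\ge\eta\|x-x'\|_2^2$. A closed proper convex $f$ with $\operatorname{int}(\operatorname{dom} f)\ne\varnothing$ is essentially smooth if it is differentiable on $\operatorname{int}(\operatorname{dom} f)$ and $\|\nabla f(x_k)\|\to\infty$ for every sequence $(x_k)$ in $\operatorname{int}(\operatorname{dom}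 f)$ converging to a boundary point; it is essentially strictly convex if it is strictly convex on every convex subset of $\operatorname{dom}(\partial f)$; it is Legendre if both hold. The mirror map $C^p:\mathbb{R}^{n_p}\to\Omega^p$ induced by $\psi^p=\epsilon\vartheta^p$ is $C^p(z^p)=\operatorname{argmax}_{y^p\in\Omega^p}\left[{y^p}^\top z^p-\epsilon\vartheta^p(y^p)\right]$, and $C(z)=(C^p(z^p))_{p\in\mathcal N}$. Standing assumption: $\vartheta^p$ is chosen so that the dual space is unconstrained, i.e. the convex conjugate ${\psi^p}^\star$ has $\operatorname{dom}({\psi^p}^\star)=\mathbb{R}^{n_p}$ (so that $C^p$ is defined on all of $\mathbb{R}^{n_p}$). A rest point of DMD is a point $\overline z\in\mathbb{R}^n$ with $\overline z=U(C(\overline z))$. A perturbed Nash equilibrium of $\mathcal{G}$ is a profile $\overline x\in\Omega$ that is a Nash equilibrium for the perturbed payoffs $\widetilde{\mathcal{U}}^p(x^p;x^{-p})=\mathcal{U}^p(x^p;x^{-p})-\epsilon\vartheta^p(x^p)$, i.e. $\widetilde{\mathcal{U}}^p(\overline x^p;\overline x^{-p})\ge\widetilde{\mathcal{U}}^p(x^p;\overline x^{-p})$ for all $x^p\in\Omega^p$, $p\in\mathcal{N}$. *)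

(* Defs.v *)
From HB Require Import structures.
From mathcomp Require Import all_boot all_order all_algebra.
From mathcomp Require Import all_classical all_reals all_analysis.

Set Implicit Arguments.
Unset Strict Implicit.
Unset Printing Implicit Defensive.

Import Order.TTheory GRing.Theory Num.Theory.
Import numFieldNormedType.Exports.

Local Open Scope classical_set_scope.
Local Open Scope ring_scope.

Definition dotv (R : realType) (n : nat) (x y : 'rV[R]_n) : R :=
  (x *m y^T) 0 0.

(* The library norm `|x| on 'rV_n is the sup norm. *)
Definition norm2 (R : realType) (n : nat) (x : 'rV[R]_n) : R :=
  Num.sqrt (dotv x x).

Section ConvexAnalysis.
Context {R : realType} {n : nat}.
Implicit Types (f : 'rV[R]_n -> \bar R) (A : set 'rV[R]_n).

Definition dom f : set 'rV[R]_n := [set x | (f x < +oo)%E].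

Definition epigraph f : set ('rV[R]_n * R) :=
  [set xa | (f xa.1 <= (xa.2)%:E)%E].

Definition closed_fun f : Prop := closed (epigraph f).

Definition proper_fun f : Prop :=
  (forall x, (-oo < f x)%E) /\ dom f !=set0.

Definition convex_fun f : Prop :=
  forall (x y : 'rV[R]_n) (t : R), 0 <= t <= 1 ->
    (f (t *: x + (1 - t) *: y)%R <= t%:E * f x + (1 - t)%:E * f y)%E.

Definition subdifferential f (x : 'rV[R]_n) : set 'rV[R]_n :=
  [set g | forall y, (f x + (dotv g (y - x))%:E <= f y)%E].

Definition dom_subdifferential f : set 'rV[R]_n :=
  [set x | subdifferential f x !=set0].

Definition strictly_convex_on f A : Prop :=
  forall (x y : 'rV[R]_n) (t : R), A x -> A y -> x != y -> 0 < t < 1 ->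
    (f (t *: x + (1 - t) *: y)%R < t%:E * f x + (1 - t)%:E * f y)%E.

Definition gradient (g : 'rV[R]_n -> R) (x : 'rV[R]_n) : 'rV[R]_n :=
  \row_i 'D_(delta_mx 0 i) g x.

Definition essentially_smooth f : Prop :=
  (forall x, interior (dom f) x -> differentiable (fine \o f) x) /\
  (forall (u : nat -> 'rV[R]_n) (a : 'rV[R]_n),
     (forall k, interior (dom f) (u k)) ->
     (closure (interior (dom f)) `\` interior (dom f)) a ->
     u @ \oo --> a ->
     norm2 (gradient (fine \o f) (u k)) @[k --> \oo] --> +oo).

Definition essentially_strictly_convex f : Prop :=
  forall A, convex_set A -> A `<=` dom_subdifferential f ->
    strictly_convex_on f A.

Definition legendre f : Prop :=
  essentially_smooth f /\ essentially_strictly_convex f.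

Definition conjugate f (z : 'rV[R]_n) : \bar R :=
  ereal_sup [set ((dotv y z)%:E - f y)%E | y in setT].

(* Gradient of g relative to A: the first-order expansion is only required
   along A, so that it makes sense at boundary points of A. It is unique when A
   is convex with nonempty interior. *)
Definition is_gradient_on A (g : 'rV[R]_n -> R) (x v : 'rV[R]_n) : Prop :=
  (g y - g x - dotv v (y - x)) / norm2 (y - x) @[y --> within A x^'] --> 0.

Definition gradient_on A (g : 'rV[R]_n -> R) (x : 'rV[R]_n) : 'rV[R]_n :=
  xget 0 [set v | is_gradient_on A g x v].

Definition continuously_differentiable_on A (g : 'rV[R]_n -> R) : Prop :=
  (forall x, A x -> exists v, is_gradient_on A g x v) /\
  {within A, continuous (gradient_on A g)}.

(* -F is monotone on A *)
Definition neg_monotone A (F : 'rV[R]_n -> 'rV[R]_n) : Prop :=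
  forall x x', A x -> A x' -> 0 <= - dotv (F x - F x') (x - x').

Definition neg_strictly_monotone A (F : 'rV[R]_n -> 'rV[R]_n) : Prop :=
  forall x x', A x -> A x' -> x != x' -> 0 < - dotv (F x - F x') (x - x').

Definition neg_strongly_monotone (eta : R) A (F : 'rV[R]_n -> 'rV[R]_n) : Prop :=
  forall x x', A x -> A x' ->
    eta * norm2 (x - x') ^+ 2 <= - dotv (F x - F x') (x - x').

End ConvexAnalysis.

(* Players are indexed from 0. Profiles are the vectors of R^(sum_p n_p), whose
   p-th block is x^p; a payoff is a total function of which only the values on
   the joint action set matter. *)
Record game (R : realType) := Game {
  nplayers : nat ;
  ndim : 'I_nplayers -> nat ;
  actions : forall p : 'I_nplayers, set 'rV[R]_(ndim p) ;
  payoff : 'I_nplayers -> 'rV[R]_(\sum_p ndim p) -> R }.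

Arguments actions {R} g p _.
Arguments payoff {R} g _ _.

Notation profile G := 'rV_(\sum_p @ndim _ G p).

Section Games.
Context {R : realType} (G : game R).

Definition block (x : profile G) (p : 'I_(nplayers G)) :
  'rV[R]_(ndim p) := submxrow x p.

(* (y; x^{-p}) *)
Definition deviate (x : profile G) (p : 'I_(nplayers G))
    (y : 'rV[R]_(ndim p)) : profile G :=
  \mxrow_q dfwith (block x) p y q.

Definition joint_actions : set (profile G) :=
  [set x | forall p, actions G p (block x p)].

(* Quantifying over x^{-p} amounts to quantifying over x in the joint action
   set, since y overwrites the p-th block and no action set is empty. *)
Definition concave_game : Prop :=
  forall p : 'I_(nplayers G),
    [/\ actions G p !=set0, closed (actions G p) &
        convex_set (actions G p)] /\
    [/\ {within joint_actions, continuous (payoff G p)},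
        (forall x, joint_actions x ->
           convex_function (actions G p)
             (fun y => - payoff G p (deviate x y))) &
        (forall x, joint_actions x ->
           continuously_differentiable_on (actions G p)
             (fun y => payoff G p (deviate x y)))].

Definition pseudo_gradient (x : profile G) :
  profile G :=
  \mxrow_p gradient_on (actions G p)
             (fun y => payoff G p (deviate x y)) (block x p).

Definition coercive_payoff (p : 'I_(nplayers G)) : Prop :=
  forall x, joint_actions x ->
    forall M : R, exists r : R, forall y, actions G p y ->
      r <= norm2 y -> M <= - payoff G p (deviate x y).

Definition nash_equilibrium
    (V : 'I_(nplayers G) -> profile G -> \bar R)
    (x : profile G) : Prop :=
  joint_actions x /\
  forall p (y : 'rV[R]_(ndim p)), actions G p y -> (V p (deviate x y) <= V p x)%E.

Variables (eps : R) (theta : forall p : 'I_(nplayers G),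
                                'rV[R]_(ndim p) -> \bar R).

Definition perturbed_payoff (p : 'I_(nplayers G))
    (x : profile G) : \bar R :=
  ((payoff G p x)%:E - eps%:E * theta (block x p))%E.

Definition perturbed_nash : set (profile G) :=
  nash_equilibrium perturbed_payoff.

Definition regularizer (p : 'I_(nplayers G)) (y : 'rV[R]_(ndim p)) : \bar R :=
  (eps%:E * theta y)%E.

Definition argmax_set (p : 'I_(nplayers G)) (zp : 'rV[R]_(ndim p)) :
    set 'rV[R]_(ndim p) :=
  [set y | actions G p y /\ forall y', actions G p y' ->
     ((dotv y' zp)%:E - regularizer y' <= (dotv y zp)%:E - regularizer y)%E].

(* The argmax is a singleton under the hypotheses of the theorem. *)
Definition mirror_map (z : profile G) :
  profile G :=
  \mxrow_p xget 0 (argmax_set (block z p)).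

Definition rest_point : set (profile G) :=
  [set z | z = pseudo_gradient (mirror_map z)].

(* Forward trajectories: the initial condition is z 0, and no derivative is
   required at time 0. *)
Definition DMD (gamma : R) (z x u : R -> profile G) : Prop :=
  {within `[0, +oo[, continuous z} /\
  [/\ (forall t : R, 0 < t -> is_derive t 1 z (gamma *: (- z t + u t))),
      (forall t : R, 0 <= t -> x t = mirror_map (z t)) &
      (forall t : R, 0 <= t -> u t = pseudo_gradient (x t))].

End Games.

Arguments joint_actions {R} G _.
Arguments concave_game {R} G.
Arguments pseudo_gradient {R} G x.
Arguments coercive_payoff {R} G p.
Arguments regularizer {R} G eps theta p y.
Arguments mirror_map {R} G eps theta z.
Arguments rest_point {R} G eps theta _.
Arguments perturbed_nash {R} G eps theta _.
Arguments DMD {R} G eps theta gamma z x u.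

(* Main.v *)
Require Import Defs.
From mathcomp Require Import all_boot all_order all_algebra.
From mathcomp Require Import all_classical all_reals all_analysis.
From mathcomp Require Import ring lra.
Import Order.TTheory GRing.Theory Num.Theory.
Import numFieldNormedType.Exports.
Local Open Scope classical_set_scope.
Local Open Scope ring_scope.

(** Write s for the convex conjugate of the joint regularizer phi, and C for the
mirror map, which is the gradient of s.  Each of the three monotonicity
hypotheses makes -U monotone.

Convergence is governed by one Lyapunov function.  For a rest point zb with
xb = C zb, the Fenchel gap
    V(z) = phi(xb) + s(z) - <xb, z>
is nonnegative and convex, and along a trajectory
    V' = gamma <x - xb, -(z - zb)> + gamma <x - xb, U x - U xb>.
The last term is nonpositive by monotonicity; the first is at most - gamma V,
because <x - xb, z - zb> is the sum of the two Bregman gaps between z and zb,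
one of which is V.  Hence V tends to 0 (differential_decay).  A zero z of V has
xb = C z, and essential smoothness of the regularizer makes C injective, so zb
is the only zero; a convex function grows linearly away from its unique zero
(convex_growth), so that V(z(t)) -> 0 forces z(t) -> zb (dual_gap_cvg).

The Legendre property enters only through C: strict convexity makes the argmax
unique, and essential smoothness confines subgradients to the interior of the
domain (dom_subdifferential_interior), where the gradient is the only one, so
that z is determined by C z.  Continuity of C is once more an instance of linear
growth (mirror_continuous_dist).  These facts are gathered in the predicate
mirror_pair, which passes from the players to the whole game by taking products
(joint_mirror_pair).

A rest point is a solution of a monotone variational inequality, and Minty's
method produces one without a fixed-point theorem.  For finitely many test points a solution of the inequality
comes from minimizing a smooth function over a simplex (finite_minty);
compactness of the sublevel sets of a tilted phi extends it to all test points
(minty); continuity of U along segments then moves the test value from U(y) to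
U(x) (rest_point_exists).

At a rest point, zb^p is both a subgradient of the regularizer and a gradient of
the concave payoff of player p; adding the two inequalities gives the perturbed
Nash property (rest_point_perturbed_nash). *)

(** * The dot product *)

Section DotProduct.
Context {R : realType} {n : nat}.
Implicit Types x y z : 'rV[R]_n.

Lemma dotvE x y : dotv x y = \sum_i x 0 i * y 0 i.
Proof. by rewrite /dotv mxE; apply: eq_bigr => i _; rewrite mxE. Qed.

Lemma dotvC x y : dotv x y = dotv y x.
Proof. by rewrite !dotvE; apply: eq_bigr => i _; rewrite mulrC. Qed.

Lemma dotvDl x y z : dotv (x + y) z = dotv x z + dotv y z.
Proof. by rewrite /dotv mulmxDl mxE. Qed.

Lemma dotvZl (a : R) x z : dotv (a *: x) z = a * dotv x z.
Proof. by rewrite /dotv -scalemxAl mxE. Qed.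

Lemma dotvNl x z : dotv (- x) z = - dotv x z.
Proof. by rewrite -scaleN1r dotvZl mulN1r. Qed.

Lemma dotvDr x y z : dotv z (x + y) = dotv z x + dotv z y.
Proof. by rewrite dotvC dotvDl !(dotvC z). Qed.

Lemma dotvZr (a : R) x z : dotv z (a *: x) = a * dotv z x.
Proof. by rewrite dotvC dotvZl (dotvC z). Qed.

Lemma dotvNr x z : dotv z (- x) = - dotv z x.
Proof. by rewrite dotvC dotvNl (dotvC z). Qed.

Lemma dotv_sumr m (l : 'I_m -> R) (v : 'I_m -> 'rV[R]_n) x :
  dotv x (\sum_i l i *: v i) = \sum_i l i * dotv x (v i).
Proof.
rewrite /dotv raddf_sum mulmx_sumr summxE; apply: eq_bigr => i _.
by rewrite -[LHS]/(dotv x _) dotvZr.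
Qed.

Lemma dotv_delta x i : dotv x (delta_mx 0 i) = x 0 i.
Proof.
rewrite dotvE (bigD1 i)//= mxE !eqxx mulr1 big1 ?addr0// => j ji.
by rewrite mxE (negbTE ji) andbF mulr0.
Qed.

Lemma normr_entry_le x i : `|x 0 i| <= `|x|.
Proof.
rewrite [leRHS]/Num.Def.normr /= mx_normrE.
by apply/bigmax_geP; right => /=; exists (ord0, i).
Qed.

Lemma normr_le_entries x (M : R) : 0 <= M -> (forall i, `|x 0 i| <= M) ->
  `|x| <= M.
Proof.
move=> M0 xM; rewrite [leLHS]/Num.Def.normr /= mx_normrE.
by apply/bigmax_leP; split=> // -[i j] _ /=; rewrite ord1.
Qed.

Lemma normr_dotv x y : `|dotv x y| <= n%:R * (`|x| * `|y|).
Proof.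
rewrite dotvE (le_trans (ler_norm_sum _ _ _))//.
rewrite (@le_trans _ _ (\sum_(i < n) `|x| * `|y|))//.
  by apply: ler_sum => i _; rewrite normrM ler_pM// normr_entry_le.
by rewrite sumr_const card_ord mulr_natl.
Qed.

Lemma cvg_dotv {T : Type} {F : set_system T} {FF : Filter F}
    (f g : T -> 'rV[R]_n) (a b : 'rV[R]_n) :
  f @ F --> a -> g @ F --> b -> dotv (f t) (g t) @[t --> F] --> dotv a b.
Proof.
move=> fa gb; under eq_fun do rewrite dotvE; rewrite dotvE.
apply: cvg_big => [|i _].
  by move=> [u v] /=; apply: add_continuous.
by apply: cvgM; [exact: cvg_comp fa (@coord_continuous R 1 n 0 i a)
  |exact: cvg_comp gb (@coord_continuous R 1 n 0 i b)].
Qed.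

End DotProduct.
Local Notation dotv_lin :=
  (dotvDl, dotvDr, dotvNl, dotvNr, dotvZl, dotvZr).

(** * Compactness and convex growth *)

Lemma cvg_norm_sub {R : realType} {V : normedModType R} {T : Type}
    {F : set_system T} {FF : Filter F} (f : T -> V) (a b : V) :
  f @ F --> a -> `|f t - b| @[t --> F] --> `|a - b|.
Proof. by move=> fa; apply: cvg_norm; apply: cvgB => //; exact: cvg_cst. Qed.

Lemma closed_distP {R : realType} {V : normedModType R} (A : set V) :
  closed A <->
  (forall x, (forall e : R, 0 < e -> exists2 y, A y & `|y - x| < e) -> A x).
Proof.
split=> [cA x xA|xA x clx].
  apply: cA => B /nbhs_ballP[e e0 eB]; have [y Ay yx] := xA e e0.
  by exists y; split=> //; apply: eB; rewrite -ball_normE /= distrC.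
apply: xA => e e0; have [y [Ay]] := clx _ (nbhsx_ballx x _ e0).
by rewrite -ball_normE /= distrC => yx; exists y.
Qed.

(** The sets where g does not exceed g y, for y in K, have the finite
intersection property: a minimizer over finitely many such y lies in all of
them.  A common point of all of them minimizes g. *)
Lemma compact_attains_min {T : ptopologicalType} {R : realType} (K : set T)
    (g : T -> R) :
  compact K -> K !=set0 -> (forall r, closed (K `&` [set x | g x <= r])) ->
  exists2 x, K x & forall y, K y -> g x <= g y.
Proof.
move=> cK K0 cg.
have := cK; rewrite compact_In0.
move=> /(_ T K (fun y => K `&` [set x | g x <= g y])); case.
- exists (fun y => K `&` [set x | g x <= g y]) => [i _|i Ki]; first exact: cg.
  by rewrite setIA setIid.
- move=> D' D'K.
  have [x Kx xmin] : exists2 x, K x &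
      forall y, y \in finmap.enum_fset D' -> g x <= g y.
    have {}D'K : forall y, y \in finmap.enum_fset D' -> y \in K by [].
    elim: (finmap.enum_fset D') D'K => [|y s IHs] sK.
      by case: K0 => x Kx; exists x.
    have [//|x Kx xmin] := IHs _.
      by move=> w ws; apply: sK; rewrite inE ws orbT.
    have Ky : K y by apply/set_mem/sK; rewrite inE eqxx.
    have [xy|/ltW yx] := leP (g x) (g y).
      by exists x => // w; rewrite inE => /predU1P[->//|/xmin].
    exists y => // w; rewrite inE => /predU1P[->//|/xmin]; exact: le_trans.
  by exists x => y /= /xmin.
- move=> x xmin; case: (K0) => w Kw; have [Kx _] := xmin w Kw.
  by exists x => // y /xmin[].
Qed.

(** On the sphere of radius e around y0 the function has a positive minimum by
compactness.  Any farther point projects radially onto that sphere, and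
convexity along the ray turns this minimum into a bound that is linear in the
distance. *)
Lemma convex_growth {R : realType} {n : nat} (Om : set 'rV[R]_n)
    (D : 'rV[R]_n -> R) (y0 : 'rV[R]_n) :
  closed Om ->
  (forall r, closed [set y | Om y /\ D y <= r]) ->
  (forall y, Om y -> y != y0 -> 0 < D y) ->
  (forall y t, Om y -> 0 <= t <= 1 ->
     Om (t *: y + (1 - t) *: y0) /\ D (t *: y + (1 - t) *: y0) <= t * D y) ->
  forall e : R, 0 < e ->
  exists2 m : R, 0 < m &
    forall y, Om y -> e <= `|y - y0| -> m * `|y - y0| <= D y.
Proof.
move=> cOm cD D0 DV e e0.
pose K := Om `&` [set y | `|y - y0| = e].
have radial y : Om y -> e <= `|y - y0| ->
    exists2 w, K w & D w <= e / `|y - y0| * D y.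
  move=> Oy ey; have y0_gt0 := lt_le_trans e0 ey.
  set t := e / _; have t01 : 0 <= t <= 1.
    by rewrite divr_ge0 ?(ltW e0)//= ler_pdivrMr// mul1r.
  have [Ow Dw] := DV _ _ Oy t01.
  exists (t *: y + (1 - t) *: y0) => //; split => //=.
  have -> : t *: y + (1 - t) *: y0 - y0 = t *: (y - y0).
    by apply/matrixP => i j; rewrite !mxE; ring.
  by rewrite normrZ ger0_norm ?(andP t01).1// /t divfK// gt_eqF.
have [K0|K0] := pselect (K !=set0); last first.
  exists 1 => // y Oy /(radial y Oy)[w Kw].
  by case: K0; exists w.
have cS : closed [set y : 'rV[R]_n | `|y - y0| = e].
  have cn : continuous (fun y : 'rV[R]_n => `|y - y0|).
    by move=> y; apply: (cvg_norm_sub (FF := nbhs_filter y)); exact: cvg_id.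
  rewrite -/((fun y : 'rV[R]_n => `|y - y0|) @^-1` [set x | x = e]).
  by apply: (preimage_closed _ (@closed_eq _ e)) => y _; exact: cn.
have cK : compact K.
  apply: bounded_closed_compact; last exact: closedI.
  exists (e + `|y0|); split; first exact: num_real.
  move=> M eM y [_ /= ye]; apply: le_trans (ltW eM).
  by rewrite -[y](subrK y0) (le_trans (ler_normD _ _))// ye.
have [|x [Ox xe] xmin] := @compact_attains_min _ _ K D cK K0.
  move=> r; rewrite (_ : _ `&` _ =
      [set y | Om y /\ D y <= r] `&` [set y | `|y - y0| = e]).
    exact: closedI.
  by apply/seteqP; split=> y /= => [[[]]|[[]]].
have Dx : 0 < D x.
  apply: D0 => //; apply/eqP => xy; move: xe => /=.
  by rewrite xy subrr normr0 => /esym/eqP; rewrite gt_eqF.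
(* the slope from y0 to the lowest point of the sphere *)
exists (D x / e) => [|y Oy ey]; first exact: divr_gt0.
have [w Kw Dw] := radial y Oy ey.
have := le_trans (xmin w Kw) Dw.
have y0_gt0 := lt_le_trans e0 ey.
by rewrite mulrAC ler_pdivlMr// [leRHS]mulrC mulrAC ler_pdivrMr.
Qed.

Lemma within_continuous_dist {R : realType} {V W : normedModType R} (A : set V)
    (f : V -> W) (x : V) (e : R) :
  {within A, continuous f} -> A x -> 0 < e ->
  exists2 d : R, 0 < d & forall y, A y -> `|y - x| < d -> `|f y - f x| < e.
Proof.
move=> /subspace_continuousP cf Ax e0.
have /cvgrPdist_lt /(_ e e0) := cf x Ax.
move=> /nbhs_ballP[d d0 hd]; exists d => // y Ay yx.
by rewrite distrC; apply: hd => //; rewrite -ball_normE /= distrC.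
Qed.

(** * Convex functions with a finite conjugate *)

Section Tilt.
Context {R : realType} {n : nat} (Om : set 'rV[R]_n) (phi : 'rV[R]_n -> R).
Implicit Types x y z v w : 'rV[R]_n.

Definition lsc_on := forall x (r : R), Om x -> r < phi x ->
  exists2 d : R, 0 < d & forall y, Om y -> `|y - x| < d -> r < phi y.

(** Finiteness of the convex conjugate of phi. *)
Definition tilt_bounded :=
  forall w, exists k : R, forall y, Om y -> dotv y w - phi y <= k.

Lemma affine_usc (v : 'rV[R]_n) (b : R) x (e : R) : 0 < e ->
  exists2 d : R, 0 < d &
    forall y, `|y - x| < d -> dotv v y + b < dotv v x + b + e.
Proof.
move=> e0; pose K : R := n%:R * `|v| + 1.
have K0 : 0 < K by rewrite ltr_wpDl// mulr_ge0.
exists (e / K) => [|y]; first exact: divr_gt0.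
rewrite ltr_pdivlMr// => yx; have := normr_dotv v (y - x).
rewrite !dotv_lin ler_norml => /andP[_].
have : 0 <= `|y - x| by [].
move: yx; rewrite /K => h1 h2 h3; nra.
Qed.

Hypotheses (cOm : closed Om) (lphi : lsc_on).

(** An affine function is continuous, hence subtracting it keeps phi lower
semicontinuous; the sublevel sets of the tilted function are closed. *)
Lemma sublevel_closed v (b : R) : closed [set x | Om x /\ phi x <= dotv v x + b].
Proof.
apply/closed_distP => x clx; have Ox : Om x.
  move: cOm => /closed_distP; apply => e /clx[y [Oy _]] yx.
  by exists y.
split=> //; rewrite leNgt; apply/negP => ax.
have r_phi : (dotv v x + b + phi x) / 2 < phi x by lra.
have [d1 d1_gt0 h1] := lphi _ _ Ox r_phi.
have [|d2 d2_gt0 h2] := affine_usc v b x ((phi x - (dotv v x + b)) / 2).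
  lra.
have [|y [Oy ya] yx] := clx (Num.min d1 d2); first by rewrite lt_min d1_gt0.
by move: yx ya; rewrite lt_min => /andP[/(h1 _ Oy) y1 /h2 y2] /=; lra.
Qed.

Hypothesis bphi : tilt_bounded.

(** Finiteness of the conjugate at v + e_i and v - e_i bounds the i-th coordinate
on both sides: a finite conjugate means superlinear growth. *)
Lemma sublevel_compact v (b : R) :
  compact [set x | Om x /\ phi x <= dotv v x + b].
Proof.
apply: bounded_closed_compact; last exact: sublevel_closed.
have [k hk] := choice bphi.
pose B := \sum_(i < n)
  (`|k (v + delta_mx 0 i) + b| + `|k (v - delta_mx 0 i) + b|).
exists B; split; first exact: num_real.
move=> M BM x [Ox xb]; apply: le_trans (ltW BM); move=> {M BM}.
apply: normr_le_entries => [|i].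
  by apply: sumr_ge0 => i _; rewrite addr_ge0.
have hi : `|k (v + delta_mx 0 i) + b| + `|k (v - delta_mx 0 i) + b| <= B.
  by rewrite /B (bigD1 i)//= lerDl sumr_ge0// => j _; rewrite addr_ge0.
have := hk (v + delta_mx 0 i) _ Ox.
have := hk (v - delta_mx 0 i) _ Ox.
rewrite !dotv_lin !dotv_delta (dotvC x v) => h1 h2.
have := ler_norm (k (v + delta_mx 0 i) + b).
have := ler_norm (k (v - delta_mx 0 i) + b).
have := normr_ge0 (k (v + delta_mx 0 i) + b).
have := normr_ge0 (k (v - delta_mx 0 i) + b).
move: hi h1 h2 xb; move: (dotv v x) (phi x) B (x 0 i) => p q ? xi.
move: (k _) (k _) => s1 s2 *.
rewrite ler_norml; apply/andP; split; lra.
Qed.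

Lemma tilt_attains_max z : Om !=set0 ->
  exists2 x, Om x & forall y, Om y -> dotv y z - phi y <= dotv x z - phi x.
Proof.
move=> [y0 Oy0].
have y0K : Om y0 /\ phi y0 <= dotv z y0 + (phi y0 - dotv z y0).
  by split=> //; lra.
have [|r|x [Ox xy0] xmin] := compact_attains_min _ (fun y => phi y - dotv z y)
    (sublevel_compact z (phi y0 - dotv z y0)).
- by exists y0.
- rewrite (_ : _ `&` _ =
      [set y | Om y /\ phi y <= dotv z y + (phi y0 - dotv z y0)] `&`
      [set y | Om y /\ phi y <= dotv z y + r]).
    by apply: closedI; exact: sublevel_closed.
  apply/seteqP; split=> y /= [[Oy yb]].
    by move=> yr; split=> //; split=> //; lra.
  by move=> [_ yr]; split=> //; lra.
exists x => // y Oy; rewrite !(dotvC _ z).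
have [yK|] := leP (phi y) (dotv z y + (phi y0 - dotv z y0)); last lra.
have := xmin y (conj Oy yK); lra.
Qed.

End Tilt.

(** * Mirror maps *)

(** What is used of a regularizer phi on its domain Om and of its mirror map c.
The Legendre property is reduced to uniqueness of the maximizer and injectivity
of c; in this form the predicate is stable under products, so that it applies to
a player and to the whole game alike. *)
Record mirror_pair {R : realType} {n : nat} (Om : set 'rV[R]_n)
    (phi : 'rV[R]_n -> R) (c : 'rV[R]_n -> 'rV[R]_n) : Prop := MirrorPair {
  mp_convex : forall x y (t : R), Om x -> Om y -> 0 <= t <= 1 ->
    Om (t *: x + (1 - t) *: y) /\
    phi (t *: x + (1 - t) *: y) <= t * phi x + (1 - t) * phi y ;
  mp_closed : closed Om ;
  mp_lsc : lsc_on Om phi ;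
  mp_dom : forall z, Om (c z) ;
  mp_max : forall z y, Om y ->
    dotv y z - phi y <= dotv (c z) z - phi (c z) ;
  mp_uniq : forall z x, Om x ->
    (forall y, Om y -> dotv y z - phi y <= dotv x z - phi x) -> x = c z ;
  mp_inj : injective c }.

Arguments mp_convex {R n Om phi c}.
Arguments mp_closed {R n Om phi c}.
Arguments mp_lsc {R n Om phi c}.
Arguments mp_dom {R n Om phi c}.
Arguments mp_max {R n Om phi c}.
Arguments mp_uniq {R n Om phi c}.
Arguments mp_inj {R n Om phi c}.

(** The value at z of the convex conjugate of phi, when c is its mirror map. *)
Definition conj_value {R : realType} {n : nat} (phi : 'rV[R]_n -> R)
    (c : 'rV[R]_n -> 'rV[R]_n) (z : 'rV[R]_n) : R :=
  dotv (c z) z - phi (c z).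

Section MirrorPair.
Context {R : realType} {n : nat} {Om : set 'rV[R]_n} {phi : 'rV[R]_n -> R}
  {c : 'rV[R]_n -> 'rV[R]_n}.
Hypothesis mp : mirror_pair Om phi c.
Implicit Types x y z w : 'rV[R]_n.

Local Notation s := (conj_value phi c).

Lemma conj_value_sub z w : dotv (c z) (w - z) <= s w - s z.
Proof.
have := mp_max mp w _ (mp_dom mp z); rewrite /conj_value !dotv_lin; lra.
Qed.

Lemma mp_sublevel_compact v (b : R) :
  compact [set x | Om x /\ phi x <= dotv v x + b].
Proof.
apply: sublevel_compact (mp_closed mp) (mp_lsc mp) _ _ _ => w.
by exists (s w) => y; exact: mp_max.
Qed.

(** The maximizer for z0 beats every other point by a margin that is linear in the
distance, however little convexity phi has. *)
Lemma mirror_growth z0 (e : R) : 0 < e ->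
  exists2 m : R, 0 < m & forall y, Om y -> e <= `|y - c z0| ->
    m * `|y - c z0| <= phi y - dotv y z0 + s z0.
Proof.
apply: convex_growth; first exact: mp_closed mp.
- move=> r; rewrite (_ : [set _ | _] =
      [set y | Om y /\ phi y <= dotv z0 y + (r - s z0)]).
    exact: sublevel_closed (mp_closed mp) (mp_lsc mp) _ _.
  apply/seteqP; split=> y /= [Oy h]; split=> //; move: h;
    by rewrite (dotvC y); lra.
- move=> y Oy; apply: contraNT; rewrite -leNgt => h; apply/eqP.
  apply: (mp_uniq mp) => // w Ow; have := mp_max mp z0 _ Ow.
  by move: h; rewrite /conj_value; lra.
- move=> y t Oy t01; have [Oty h] := mp_convex mp _ _ _ Oy (mp_dom mp z0) t01.
  by split=> //; move: h; rewrite /conj_value !dotv_lin; lra.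
Qed.

(** By optimality of c z for z, the loss of c z in the problem for z0 is at most
<c z - c z0, z - z0>; if c z were at distance e or more, linear growth would make
this loss at least m |c z - c z0|, which is too much once z is close to z0. *)
Lemma mirror_continuous_dist z0 (e : R) : 0 < e ->
  exists2 d : R, 0 < d & forall z, `|z - z0| < d -> `|c z - c z0| < e.
Proof.
move=> e0; have [m m0 hm] := mirror_growth z0 _ e0.
have n0 : 0 < n%:R + 1 :> R by rewrite ltr_wpDl.
exists (m / (n%:R + 1)) => [|z]; first exact: divr_gt0.
rewrite ltr_pdivlMr// => zm; rewrite ltNge; apply/negP => ec.
have := hm _ (mp_dom mp z) ec; have := conj_value_sub z0 z.
have := normr_dotv (c z - c z0) (z - z0).
rewrite ler_norml => /andP[_].
have : 0 <= `|z - z0| by [].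
move: ec zm e0; rewrite /conj_value !dotv_lin.
move: `|c z - c z0| `|z - z0| => a b; nra.
Qed.

Lemma cvg_mirror {T : Type} {F : set_system T} {FF : Filter F}
    (f : T -> 'rV[R]_n) z0 : f @ F --> z0 -> c (f t) @[t --> F] --> c z0.
Proof.
move=> /cvgrPdist_lt fz; apply/cvgrPdist_lt => e /(mirror_continuous_dist z0).
move=> [d /fz fd cd]; apply: filterS fd => t.
by rewrite distrC [`|c _ - _|]distrC; exact: cd.
Qed.

(** The increment of s lies between its two linear estimates, with slopes c z0 and
c (f t); both estimates vanish in the limit. *)
Lemma cvg_conj_value {T : Type} {F : set_system T} {FF : Filter F}
    (f : T -> 'rV[R]_n) z0 : f @ F --> z0 -> s (f t) @[t --> F] --> s z0.
Proof.
move=> fz.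
have fz0 : f t - z0 @[t --> F] --> (0 : 'rV[R]_n).
  by rewrite -(subrr z0); apply: cvgB => //; exact: cvg_cst.
have h (g : T -> 'rV[R]_n) (a : 'rV[R]_n) : g @ F --> a ->
    s z0 + dotv (g t) (f t - z0) @[t --> F] --> s z0.
  move=> ga; have d0 : dotv a 0 = 0 by rewrite dotvC /dotv mul0mx mxE.
  suff : s z0 + dotv (g t) (f t - z0) @[t --> F] --> s z0 + dotv a 0.
    by rewrite d0 addr0.
  by apply: cvgD; [exact: cvg_cst|exact: cvg_dotv].
have sq : \near F, s z0 + dotv (c z0) (f F - z0) <= s (f F) <=
    s z0 + dotv (c (f F)) (f F - z0).
  apply: nearW => t; have := conj_value_sub z0 (f t).
  have := conj_value_sub (f t) z0; rewrite !dotv_lin => h1 h2.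
  by apply/andP; split; lra.
exact: (squeeze_cvgr sq (h _ _ (cvg_cst (c z0))) (h _ _ (cvg_mirror _ _ fz))).
Qed.

Lemma conj_value_convex z w (t : R) : 0 <= t <= 1 ->
  s (t *: w + (1 - t) *: z) <= t * s w + (1 - t) * s z.
Proof.
move=> /andP[t0 t1]; set p := (_ + _).
have hw := mp_max mp w _ (mp_dom mp p); have hz := mp_max mp z _ (mp_dom mp p).
have -> : s p = t * (dotv (c p) w - phi (c p)) +
    (1 - t) * (dotv (c p) z - phi (c p)).
  by rewrite /conj_value {2}/p !dotv_lin; ring.
by apply: lerD; apply: ler_wpM2l => //; rewrite subr_ge0.
Qed.

(** The gradient of the conjugate is c: the remainder of the first-order expansion
of s at z lies between 0 and <c z' - c z, z' - z>, which is o(|z' - z|) by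
continuity of c. *)
Lemma is_derive_conj_value (z : R -> 'rV[R]_n) (t : R) (v : 'rV[R]_n) :
  is_derive t 1 z v -> is_derive t 1 (s \o z) (dotv (c (z t)) v).
Proof.
move=> dz; have zt : {for t, continuous z}.
  by apply/differentiable_continuous/derivable1_diffP; case: dz.
pose q (h : R) : 'rV[R]_n := h^-1 *: (z (h *: 1 + t) - z t).
have qv : q @ 0^' --> v.
  by case: dz => dz <-; exact: dz.
have z0 : z (h *: 1 + t) @[h --> (0 : R)^'] --> z t.
  apply: (@cvg_comp _ _ _ (fun h : R => h *: 1 + t) z _ (nbhs t)) => //.
  apply: cvg_within_filter.
  have : h *: 1 + t @[h --> (0 : R)] --> 0 *: 1 + t.
    by apply: cvgD; [apply: cvgZr_tmp; exact: cvg_id|exact: cvg_cst].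
  by rewrite scale0r add0r.
suff h : (fun h => h^-1 *: ((s \o z) (h *: 1 + t) - (s \o z) t)) @ 0^' -->
    dotv (c (z t)) v.
  by split; [exact: cvgP h|exact: cvg_lim h].
have cz := cvg_mirror (FF := dnbhs_filter (0 : R)) _ _ z0.
pose r h := dotv (c (z (h *: 1 + t)) - c (z t)) (q h).
have r0 : `|r h| @[h --> (0 : R)^'] --> (0 : R).
  have d0 : dotv (c (z t) - c (z t)) v = 0 by rewrite subrr /dotv mul0mx mxE.
  suff : `|r h| @[h --> (0 : R)^'] --> `|dotv (c (z t) - c (z t)) v|.
    by rewrite d0 normr0.
  apply: cvg_norm; apply: cvg_dotv => //.
  by apply: cvgB => //; exact: cvg_cst.
have lim g : (forall h, `|g h| <= `|r h|) ->
    dotv (c (z t)) (q h) + g h @[h --> (0 : R)^'] --> dotv (c (z t)) v.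
  move=> gr; rewrite -[dotv (c (z t)) v]addr0; apply: cvgD.
    by apply: cvg_dotv => //; exact: cvg_cst.
  apply: norm_cvg0; apply: (squeeze_cvgr _ (cvg_cst 0) r0).
  by apply: nearW => h; rewrite normr_ge0 gr.
pose g h := h^-1 * ((s \o z) (h *: 1 + t) - (s \o z) t) - dotv (c (z t)) (q h).
rewrite (_ : (fun h => _) = fun h => dotv (c (z t)) (q h) + g h); last first.
  by apply/funext => h; rewrite /g addrCA subrr addr0.
apply: lim => h; rewrite /g /r /q dotvZr [in leRHS]dotvZr -mulrBr !normrM.
apply: ler_wpM2l => //=.
have h1 := conj_value_sub (z t) (z (h *: 1 + t)).
have h2 := conj_value_sub (z (h *: 1 + t)) (z t).
by rewrite !ger0_norm; move: h1 h2; rewrite !dotv_lin; lra.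
Qed.

(** The Fenchel gap is a convex function of the dual variable, and injectivity of c
makes z0 its only zero; linear growth away from z0 concludes. *)
Lemma dual_gap_cvg {T : Type} {F : set_system T} {FF : Filter F}
    (z : T -> 'rV[R]_n) z0 :
  phi (c z0) + s (z t) - dotv (c z0) (z t) @[t --> F] --> (0 : R) ->
  z @ F --> z0.
Proof.
move=> gap0; apply/cvgrPdist_lt => e e0.
have D0 w : 0 <= phi (c z0) + s w - dotv (c z0) w.
  by have := conj_value_sub z0 w; rewrite /conj_value !dotv_lin; lra.
have cs : forall r,
    closed [set w | setT w /\ phi (c z0) + s w - dotv (c z0) w <= r].
  move=> r; rewrite (_ : [set _ | _] =
      [set w | s w - dotv (c z0) w + phi (c z0) <= r]); last first.
    by apply/seteqP; split=> w /=; [case=> _ h|move=> h; split=> //]; lra.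
  have cont : continuous (fun w => s w - dotv (c z0) w + phi (c z0)).
    move=> w; apply: (cvgD (FF := nbhs_filter w)) (cvg_cst _).
    apply: (cvgB (FF := nbhs_filter w)).
      by apply: (cvg_conj_value (FF := nbhs_filter w)); exact: cvg_id.
    by apply: (cvg_dotv (FF := nbhs_filter w)); [exact: cvg_cst|exact: cvg_id].
  by apply: (preimage_closed _ (@closed_le _ r)) => w _; exact: cont.
have [] := @convex_growth _ _ setT
  (fun w => phi (c z0) + s w - dotv (c z0) w) z0 closedT cs _ _ e e0.
- move=> w _; apply: contraNT; rewrite -leNgt => h; apply/eqP/(mp_inj mp)/esym.
  apply: (mp_uniq mp); first exact: mp_dom mp z0.
  by move=> y /(mp_max mp w); rewrite -/(s w); lra.
- move=> w t _ /andP[t0 t1]; split=> //.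
  have := conj_value_convex z0 w t; rewrite t0 t1 => /(_ isT).
  have -> : phi (c z0) = dotv (c z0) z0 - s z0 by rewrite /conj_value; ring.
  by rewrite !dotv_lin; lra.
- move=> m m0 hm; move/cvgrPdist_lt: gap0 => /(_ (m * e) (mulr_gt0 m0 e0)).
  apply: filterS => t; rewrite sub0r normrN ger0_norm ?D0//.
  rewrite distrC !ltNge; apply: contra => et.
  by apply: le_trans (hm _ I et); rewrite ler_pM2l.
Qed.
End MirrorPair.

(** * Gradients and subgradients of convex functions *)

Lemma dnbhs_limit_le {R : realType} (q : R -> R) (l a d : R) :
  0 < d -> q @ 0^' --> l -> (forall h, 0 < h < d -> q h <= a) -> l <= a.
Proof.
move=> d0 /cvgrPdist_lt ql qa; rewrite leNgt; apply/negP => al.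
have := ql (l - a); rewrite subr_gt0 => /(_ al) /nbhs_ballP[e /= e0 he].
have m0 : 0 < Num.min e d by rewrite lt_min e0.
have /andP[me md] : (Num.min e d / 2 < e) && (Num.min e d / 2 < d).
  by rewrite -lt_min; lra.
have := he (Num.min e d / 2); rewrite -ball_normE /= sub0r normrN.
rewrite gtr0_norm ?divr_gt0// => /(_ me) => h1.
have := qa (Num.min e d / 2); rewrite divr_gt0//= => /(_ md) h2.
have : Num.min e d / 2 != 0 by rewrite gt_eqF// divr_gt0.
by move=> /h1; rewrite ltr_norml => /andP[_]; lra.
Qed.

Lemma derive_le {R : realType} {n : nat} (g : 'rV[R]_n -> R)
    (x v : 'rV[R]_n) (a : R) :
  differentiable g x ->
  (exists2 d : R, 0 < d &
     forall h, 0 < h < d -> g (h *: v + x) - g x <= h * a) ->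
  'D_v g x <= a.
Proof.
move=> dg [d d0 hd].
apply: (@dnbhs_limit_le _
  (fun h => h^-1 *: (g (h *: v + x) - g x)) _ _ d) => //.
  exact: diff_derivable dg.
move=> h /andP[h0 hd']; rewrite -[_ *: _]/(_ * _) mulrC ler_pdivrMr// mulrC.
by apply: hd; rewrite h0.
Qed.

Lemma derive_gradient {R : realType} {n : nat} (g : 'rV[R]_n -> R)
    (x v : 'rV[R]_n) :
  differentiable g x -> 'D_v g x = dotv (gradient g x) v.
Proof.
move=> dg; rewrite deriveE// [in LHS](row_sum_delta v) raddf_sum dotvE.
apply: eq_bigr => i _. rewrite [LHS]linearZ_LR /= mxE -deriveE// mulrC.
by rewrite -[_ *: _]/(_ * _).
Qed.

Section ConvexExtended.
Context {R : realType} {n : nat} (f : 'rV[R]_n -> \bar R).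
Hypotheses (closedf : closed_fun f) (properf : proper_fun f)
  (convexf : convex_fun f).
Implicit Types x y z v w g : 'rV[R]_n.
Local Notation phi := (fine \o f).

Lemma dom_fineK x : dom f x -> f x = (phi x)%:E.
Proof.
case: properf => fNy _; rewrite /dom /= => fy; rewrite fineK//.
by rewrite fin_numElt fNy fy.
Qed.

Lemma convex_on_dom x y (t : R) : dom f x -> dom f y -> 0 <= t <= 1 ->
  dom f (t *: x + (1 - t) *: y) /\
  phi (t *: x + (1 - t) *: y) <= t * phi x + (1 - t) * phi y.
Proof.
move=> fx fy t01; have := convexf x y t t01.
rewrite (dom_fineK _ fx) (dom_fineK _ fy) -!EFinM -EFinD => le.
have ft : dom f (t *: x + (1 - t) *: y) by apply: le_lt_trans le (ltry _).
by split=> //; move: le; rewrite (dom_fineK _ ft) lee_fin.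
Qed.

(** A closed epigraph misses a neighbourhood of (x, r) when r < f x. *)
Lemma lsc_on_dom : lsc_on (dom f) phi.
Proof.
move=> x r fx rx; apply: contrapT => noball.
suff : epigraph f (x, r).
  by rewrite /epigraph /= (dom_fineK _ fx) lee_fin leNgt rx.
have : closed (epigraph f) := closedf.
move/closed_distP; apply => e e0; apply: contrapT => none; apply: noball.
exists e => // y fy yx; rewrite ltNge; apply/negP => yr; apply: none.
exists (y, r); first by rewrite /epigraph /= (dom_fineK _ fy) lee_fin.
rewrite (_ : (y, r) - (x, r) = (y - x, 0)); last by congr pair; rewrite subrr.
by rewrite prod_normE /= normr0 max_l.
Qed.

Lemma subdifferentialP x g : dom f x ->
  subdifferential f x g <->
  forall y, dom f y -> phi x + dotv g (y - x) <= phi y.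
Proof.
move=> fx; split=> [sg y fy|sg y].
  by have := sg y; rewrite (dom_fineK _ fx) (dom_fineK _ fy) -EFinD lee_fin.
have [fy|] := pselect (dom f y).
  by rewrite (dom_fineK _ fx) (dom_fineK _ fy) -EFinD lee_fin; exact: sg.
by move/negP; rewrite -leNgt leye_eq => /eqP ->; rewrite leey.
Qed.

Lemma interior_domP x : interior (dom f) x <->
  exists2 e : R, 0 < e & forall y, `|y - x| < e -> dom f y.
Proof.
split=> [/nbhs_ballP[e e0 h]|[e e0 h]].
  by exists e => // y yx; apply: h; rewrite -ball_normE /= distrC.
apply/nbhs_ballP; exists e => // y; rewrite -ball_normE /= distrC; exact: h.
Qed.

Lemma gradient_subgradient x y : interior (dom f) x -> differentiable phi x ->
  dom f y -> phi x + dotv (gradient phi x) (y - x) <= phi y.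
Proof.
move=> /interior_subset fx dx fy; rewrite addrC -lerBrDr -derive_gradient//.
apply: derive_le => //; exists 1 => // h /andP[h0 h1].
have [|_] := convex_on_dom y x h fy fx; first by rewrite (ltW h0) (ltW h1).
have -> : h *: (y - x) + x = h *: y + (1 - h) *: x.
  by apply/rowP => i; rewrite !mxE; ring.
lra.
Qed.

(** Since x is interior, a subgradient bounds the directional derivative from below
in every direction and its opposite. *)
Lemma subgradient_gradient x g : interior (dom f) x -> differentiable phi x ->
  subdifferential f x g -> g = gradient phi x.
Proof.
move=> ix dx; have fx := interior_subset ix.
move=> /(subdifferentialP _ _ fx) sg.
have le v : dotv g v <= dotv (gradient phi x) v.
  rewrite -lerN2 -[in leLHS]derive_gradient// -deriveN; last first.
    exact: diff_derivable.
  apply: derive_le; first exact: differentiableN.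
  move: ix => /interior_domP[e e0 he].
  have v0 : 0 < `|v| + 1 by rewrite ltr_wpDl.
  exists (e / (`|v| + 1)) => [|h /andP[h0]]; first exact: divr_gt0.
  rewrite ltr_pdivlMr// => hv.
  have /sg : dom f (h *: v + x).
    apply: he; rewrite addrK normrZ gtr0_norm//.
    by apply: le_lt_trans hv; rewrite ler_pM2l// lerDl.
  rewrite addrK dotvZr => hle; rewrite mulrN.
  suff : - phi (h *: v + x) - - phi x <= - (h * dotv g v) by []; lra.
apply/rowP => i; apply/eqP; rewrite eq_le -!dotv_delta le /=.
by have := le (- delta_mx 0 i); rewrite !dotv_lin lerN2.
Qed.

End ConvexExtended.

(** Suppose that g is a subgradient at a boundary point x, and approach x along the
segment from an interior point a.  The gradients at the points u k of the segment
stay bounded: convexity bounds f near a, which limits how steep f can be in the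
directions away from u k, while monotonicity of subgradients bounds the gradient
from below by g in the direction of a.  This contradicts the blow-up required by
essential smoothness. *)
Lemma dom_subdifferential_interior {R : realType} {n : nat}
    (f : 'rV[R]_n -> \bar R) (x : 'rV[R]_n) :
  proper_fun f -> convex_fun f -> interior (dom f) !=set0 ->
  essentially_smooth f -> dom f x -> dom_subdifferential f x ->
  interior (dom f) x.
Proof.
move=> properf convexf [a ia] [diff_f blowup] fx [g].
move=> /(subdifferentialP _ properf _ _ fx) sg; apply: contrapT => nix.
pose phi := fine \o f; have fa := interior_subset ia.
have [r r0 ar] := (interior_domP _ _).1 ia.
pose u (k : nat) : 'rV[R]_n := harmonic k *: a + (1 - harmonic k) *: x.
have h01 k : 0 < harmonic k :> R by rewrite /= invr_gt0 ltr0n.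
have h1 k : harmonic k <= 1 :> R by rewrite invf_le1// ler1n.
have ux k : u k - x = harmonic k *: (a - x).
  by apply/rowP => i; rewrite !mxE; ring.
have iu k : interior (dom f) (u k).
  apply/interior_domP.
  exists (harmonic k * r) => [|y yu]; first exact: mulr_gt0.
  (* y is the image of b under the homothety of center x and ratio harmonic k *)
  pose b := (harmonic k)^-1 *: (y - u k) + a.
  have fb : dom f b.
    apply: ar; rewrite addrK normrZ gtr0_norm ?invr_gt0//.
    by rewrite mulrC ltr_pdivrMr// mulrC.
  have [] := convex_on_dom f properf convexf b x (harmonic k) fb fx.
    by rewrite (ltW (h01 k)) h1.
  rewrite scalerDr scalerA divff ?gt_eqF// scale1r -addrA -/(u k) subrK.
  by [].
have cu : u @ \oo --> x.
  have -> : x = 0 *: a + (1 - 0) *: x by rewrite scale0r add0r subr0 scale1r.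
  apply: cvgD; apply: cvgZr_tmp; first exact: cvg_harmonic.
  by apply: cvgB; [exact: cvg_cst|exact: cvg_harmonic].
have clx : closure (interior (dom f)) x.
  move=> B /cu [N _ /(_ N (leqnn N)) BN].
  by exists (u N); split; [exact: iu|].
have {blowup}blow := blowup u x iu (conj clx nix) cu.
pose G k := gradient phi (u k).
pose e (i : 'I_n) : 'rV[R]_n := delta_mx 0 i.
pose M i := (`|phi (a + (r / 2) *: e i)| + `|phi (a - (r / 2) *: e i)| +
  `|phi x| + `|dotv g (a - x)|) / (r / 2).
(* M i does not depend on k: the bound is read off at a + (r / 2) e_i and
   a - (r / 2) e_i *)
have GM k i : `|G k 0 i| <= M i.
  have r20 : 0 < r / 2 by lra.
  have fe (s : R) : `|s| <= r / 2 -> dom f (a + s *: e i).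
    move=> sr; apply: ar; rewrite addrAC subrr add0r normrZ.
    apply: (@le_lt_trans _ _ `|s|); last lra.
    rewrite -[leRHS]mulr1 ler_wpM2l// normr_le_entries// => j.
    by rewrite mxE eqxx /=; case: (_ == _); rewrite ?normr0 ?normr1.
  have gs y : dom f y -> phi (u k) + dotv (G k) (y - u k) <= phi y.
    by apply: gradient_subgradient => //; exact: diff_f.
  have hx : phi x + dotv g (u k - x) <= phi (u k).
    exact: sg (interior_subset (iu k)).
  have hux := gs x fx.
  (* monotonicity of the subgradients g at x and G k at u k *)
  have along_a : dotv g (a - x) <= dotv (G k) (a - x).
    rewrite -(ler_pM2l (h01 k)) -!dotvZr -ux.
    by move: hux hx; rewrite !dotv_lin; lra.
  have key s : `|s| <= r / 2 ->
      s * G k 0 i <= `|phi (a + s *: e i)| + `|phi x| + `|dotv g (a - x)|.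
    move=> /fe /gs; rewrite (_ : a + s *: e i - u k =
      s *: e i + (1 - harmonic k) *: (a - x)); last first.
      by apply/rowP => j; rewrite !mxE; ring.
    move=> hs; rewrite dotvDr !dotvZr dotv_delta in hs.
    have := ler_norm (phi (a + s *: e i)); have := ler_norm (- phi x).
    have := ler_norm (- dotv g (a - x)); rewrite !normrN.
    have hk : (1 - harmonic k) * dotv g (a - x) <=
        (1 - harmonic k) * dotv (G k) (a - x).
      by rewrite ler_wpM2l// subr_ge0.
    move: hx hs hk; rewrite ux dotvZr; lra.
  rewrite ler_pdivlMr// mulrC -[X in X * _]gtr0_norm// -normrM ler_norml.
  have := key (r / 2); have := key (- (r / 2)).
  rewrite normrN gtr0_norm// lexx scaleNr => /(_ isT) k1 /(_ isT) k2.
  have := normr_ge0 (phi (a - (r / 2) *: e i)).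
  have := normr_ge0 (phi (a + (r / 2) *: e i)).
  by move: k1 k2; rewrite mulNr => *; apply/andP; split; lra.
have : \forall k \near \oo, norm2 (G k) > Num.sqrt (\sum_i M i ^+ 2).
  move/cvgryPgt : blow; exact.
move=> [N _ /(_ N (leqnn N))] /=; apply/negP; rewrite -leNgt.
rewrite /norm2 ler_wsqrtr// dotvE; apply: ler_sum => i _.
have := GM N i; have := normr_ge0 (G N 0 i).
rewrite -expr2 -[G N 0 i ^+ 2]real_normK ?num_real// => h2 h3.
by rewrite ler_sqr ?nnegrE//; apply: le_trans h3.
Qed.

(** * Mirror maps of Legendre functions *)

Section LegendreMirror.
Context {R : realType} {n : nat} (f : 'rV[R]_n -> \bar R) (eps : R).
Hypotheses (closedf : closed_fun f) (properf : proper_fun f)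
  (convexf : convex_fun f) (int_dom : interior (dom f) !=set0)
  (legf : legendre f) (eps0 : 0 < eps) (closed_dom : closed (dom f))
  (conj_fin : dom (conjugate (fun y => eps%:E * f y)%E) = setT).
Implicit Types x y z v w g : 'rV[R]_n.
Local Notation phi := (fun y => eps * fine (f y)).

Let obj z y : dom f y ->
  ((dotv y z)%:E - eps%:E * f y)%E = (dotv y z - phi y)%:E.
Proof. by move=> fy; rewrite (dom_fineK _ properf _ fy). Qed.

Definition ereal_argmax z := [set y | dom f y /\ forall y', dom f y' ->
  ((dotv y' z)%:E - eps%:E * f y' <= (dotv y z)%:E - eps%:E * f y)%E].

Lemma ereal_argmaxP z x : ereal_argmax z x <->
  dom f x /\ forall y, dom f y -> dotv y z - phi y <= dotv x z - phi x.
Proof.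
by split=> -[fx xmax]; split=> // y fy; move: (xmax y fy);
  rewrite !obj// lee_fin.
Qed.

Lemma tilt_bounded_conjugate : tilt_bounded (dom f) phi.
Proof.
move=> w; have : dom (conjugate (fun y => eps%:E * f y)%E) w.
  by rewrite conj_fin.
rewrite /dom /=; set k := conjugate _ w => ky.
have kub y : dom f y -> ((dotv y w - phi y)%:E <= k)%E.
  by move=> fy; rewrite -obj//; apply: ereal_sup_ubound; exists y.
case: k ky kub => [r _|//|_] kub.
  by exists r => y /kub; rewrite lee_fin.
by exists 0 => y /kub.
Qed.

Lemma lsc_on_scaled : lsc_on (dom f) phi.
Proof.
move=> x r fx; rewrite mulrC -ltr_pdivrMr// => rx.
have [d d0 hd] := lsc_on_dom f closedf properf _ _ fx rx.
by exists d => // y fy yx; rewrite [ltRHS]mulrC -ltr_pdivrMr//; exact: hd.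
Qed.

Lemma convex_on_scaled x y (t : R) : dom f x -> dom f y -> 0 <= t <= 1 ->
  dom f (t *: x + (1 - t) *: y) /\
  phi (t *: x + (1 - t) *: y) <= t * phi x + (1 - t) * phi y.
Proof.
move=> fx fy t01.
have [ft le] := convex_on_dom f properf convexf _ _ _ fx fy t01.
split=> //; rewrite (mulrCA t) (mulrCA (1 - t)) -mulrDr ler_pM2l//.
Qed.

Lemma ereal_argmax_subgradient z x : ereal_argmax z x ->
  subdifferential f x (eps^-1 *: z).
Proof.
move=> /ereal_argmaxP[fx xmax].
apply/(subdifferentialP _ properf _ _ fx) => y fy.
have le := xmax y fy; rewrite -(ler_pM2l eps0) dotvZl mulrDr mulrA.
by rewrite divff ?gt_eqF// mul1r (dotvC z) !dotv_lin /=; lra.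
Qed.

(** Every maximizer has a subgradient, so the convex set of maximizers lies in the
domain of the subdifferential, on which the function is strictly convex: the
midpoint of two distinct maximizers would do better. *)
Lemma ereal_argmax_unique z x y :
  ereal_argmax z x -> ereal_argmax z y -> x = y.
Proof.
move=> zx zy; apply/eqP; apply: contrapT => /negP xy.
have sc : strictly_convex_on f (ereal_argmax z).
  apply: legf.2; last first.
    by move=> w zw; exists (eps^-1 *: z); exact: ereal_argmax_subgradient.
  move=> v w l /set_mem zv /set_mem zw; apply/mem_set/ereal_argmaxP.
  have [fv vmax] := (ereal_argmaxP _ _).1 zv.
  have [fw wmax] := (ereal_argmaxP _ _).1 zw.
  have l01 : 0 <= (l%:num : R) <= 1 by rewrite ge0 le1.
  have [fl le] := convex_on_scaled _ _ _ fv fw l01; split=> // b fb.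
  case/andP: l01 => l0 l1; have l1' : 0 <= 1 - (l%:num : R) by lra.
  have lv := ler_wpM2l l0 (vmax b fb); have lw := ler_wpM2l l1' (wmax b fb).
  suff : dotv b z - phi b <= dotv (l%:num *: v + (1 - l%:num) *: w) z -
    phi (l%:num *: v + (1 - l%:num) *: w) by [].
  by move: le lv lw; rewrite !dotv_lin; lra.
have := sc x y 2^-1 zx zy xy; have [half01 half01'] :
  (0 < (2^-1 : R) < 1) /\ (0 <= (2^-1 : R) <= 1) by split; lra.
move=> /(_ half01).
have [fx xmax] := (ereal_argmaxP _ _).1 zx.
have [fy ymax] := (ereal_argmaxP _ _).1 zy.
have [fm _] := convex_on_scaled _ _ _ fx fy half01'.
rewrite !(dom_fineK _ properf)// -!EFinM -EFinD lte_fin /= -(ltr_pM2l eps0).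
by have := xmax _ fm; have := ymax _ fm; rewrite !dotv_lin; lra.
Qed.

(** A maximizer has a subgradient, hence is an interior point, where the gradient is
the only subgradient. *)
Lemma ereal_argmax_inj z z' x :
  ereal_argmax z x -> ereal_argmax z' x -> z = z'.
Proof.
move=> zx zx'; have fx := zx.1.
have sz := ereal_argmax_subgradient _ _ zx.
have ix : interior (dom f) x.
  apply: dom_subdifferential_interior => //; first exact: legf.1.
  by exists (eps^-1 *: z).
have dx := legf.1.1 x ix.
have ez := subgradient_gradient _ properf _ _ ix dx sz.
have sz' := ereal_argmax_subgradient _ _ zx'.
have ez' := subgradient_gradient _ properf _ _ ix dx sz'.
by apply: (scalerI (a := eps^-1)); rewrite ?ez ?ez'// invr_neq0// gt_eqF.
Qed.

Lemma legendre_mirror_pair (c : 'rV[R]_n -> 'rV[R]_n) :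
  (forall z, c z = xget 0 (ereal_argmax z)) -> mirror_pair (dom f) phi c.
Proof.
move=> cE; have cz z : ereal_argmax z (c z).
  rewrite cE; apply: xgetPex.
  have [|x fx xmax] := tilt_attains_max _ _ closed_dom lsc_on_scaled
    tilt_bounded_conjugate z.
    by case: int_dom => a /interior_subset; exists a.
  by exists x; apply/ereal_argmaxP.
split => //.
- exact: convex_on_scaled.
- exact: lsc_on_scaled.
- by move=> z; have [] := cz z.
- by move=> z; have /ereal_argmaxP[] := cz z.
- move=> z x fx xmax; apply: (@ereal_argmax_unique z) => //.
  exact/ereal_argmaxP.
- move=> z z' e; apply: (@ereal_argmax_inj z z' (c z)); first exact: cz.
  by rewrite e; exact: cz.
Qed.

End LegendreMirror.

(** * Products of mirror maps *)

Section Blocks.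
Context {R : realType} {N : nat} {d : 'I_N -> nat}.
Implicit Types x y z : 'rV[R]_(\sum_p d p).

Lemma dotv_blocks x y : dotv x y = \sum_p dotv (submxrow x p) (submxrow y p).
Proof.
rewrite /dotv -{1}[x]submxrowK -{1}[y]submxrowK tr_mxrow mul_mxrow_mxcol.
by rewrite summxE.
Qed.

Lemma submxrowZ (a : R) x p : submxrow (a *: x) p = a *: submxrow x p.
Proof. by apply/matrixP => i j; rewrite !mxE. Qed.

Lemma normr_submxrow x p : `|submxrow x p| <= `|x|.
Proof.
by apply: normr_le_entries => // j; rewrite mxE; exact: normr_entry_le.
Qed.

Lemma finite_uniform_radius (A : 'I_N -> R -> Prop) :
  (forall p d d', A p d -> d' <= d -> A p d') ->
  (forall p, exists2 d : R, 0 < d & A p d) ->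
  exists2 d : R, 0 < d & forall p, A p d.
Proof.
move=> mono /(_ _)/cid2-/all_sig2[r r0 rP].
exists (\big[Num.min/1]_p r p) => [|p].
  by apply/bigmin_gtP; split=> // p _; exact: r0.
by apply: mono (rP p) _; exact: bigmin_le_cond.
Qed.

Variables (Om : forall p, set 'rV[R]_(d p)) (phi : forall p, 'rV[R]_(d p) -> R)
  (c : forall p, 'rV[R]_(d p) -> 'rV[R]_(d p)).

(** The joint objective is the sum of the players' objectives in separate
variables, so that it is maximized block by block. *)
Lemma joint_mirror_pair :
  (forall p, mirror_pair (Om p) (phi p) (c p)) ->
  mirror_pair [set x : 'rV[R]_(\sum_p d p) | forall p, Om p (submxrow x p)]
    (fun x => \sum_p phi p (submxrow x p))
    (fun z => \mxrow_p c p (submxrow z p)).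
Proof.
move=> mp; have block_max z x :
    dotv x z - \sum_p phi p (submxrow x p) =
    \sum_p (dotv (submxrow x p) (submxrow z p) - phi p (submxrow x p)).
  by rewrite dotv_blocks sumrB.
split.
- move=> x y t Ox Oy t01.
  have blk p : submxrow (t *: x + (1 - t) *: y) p =
      t *: submxrow x p + (1 - t) *: submxrow y p.
    by rewrite submxrowD !submxrowZ.
  split=> [p /=|].
    by rewrite blk; apply: (mp_convex (mp p) _ _ _ (Ox p) (Oy p) t01).1.
  rewrite !mulr_sumr -big_split /=; apply: ler_sum => p _.
  by rewrite blk; apply: (mp_convex (mp p) _ _ _ (Ox p) (Oy p) t01).2.
- apply/closed_distP => x clx p.
  move: (mp_closed (mp p)) => /closed_distP; apply => e /clx[y Oy yx].
  exists (submxrow y p) => //; rewrite -submxrowB.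
  exact: le_lt_trans (normr_submxrow _ _) yx.
- move=> x r Ox rx.
  (* each of the N terms may lose del, and the sum must not lose its margin *)
  pose del := (\sum_p phi p (submxrow x p) - r) / (N%:R + 1).
  have del0 : 0 < del by rewrite divr_gt0 ?subr_gt0 ?ltr_wpDl.
  have [|p|rad rad0 hrad] := finite_uniform_radius (fun p e =>
      forall y : 'rV[R]_(d p), Om p y -> `|y - submxrow x p| < e ->
        phi p (submxrow x p) - del < phi p y).
  + by move=> p e e' h e'e y Oy ye; apply: h => //; exact: lt_le_trans ye e'e.
  + have lt : phi p (submxrow x p) - del < phi p (submxrow x p).
      by rewrite ltrBlDr ltrDl.
    exact: mp_lsc (mp p) _ _ (Ox p) lt.
  exists rad => // y Oy yx.
  have : \sum_p (phi p (submxrow x p) - del) <= \sum_p phi p (submxrow y p).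
    apply: ler_sum => p _; apply/ltW/hrad => //; rewrite -submxrowB.
    exact: le_lt_trans (normr_submxrow _ _) yx.
  apply: lt_le_trans; rewrite sumrB sumr_const card_ord.
  have : del * (N%:R + 1) = \sum_p phi p (submxrow x p) - r.
    by rewrite divfK// gt_eqF// ltr_wpDl.
  by rewrite -mulr_natr; lra.
- by move=> z p /=; rewrite mxrowK; exact: mp_dom (mp _) _.
- move=> z y Oy; rewrite !block_max.
  by apply: ler_sum => p _; rewrite mxrowK; exact: mp_max (mp p) _ _ _.
- move=> z x Ox xmax; apply/mxrowP => p; rewrite mxrowK.
  apply: (mp_uniq (mp p)) => // y Oy.
  have Cz q : Om q (submxrow (\mxrow_q c q (submxrow z q)) q).
    by rewrite mxrowK; exact: mp_dom (mp _) _.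
  have := xmax _ Cz; rewrite !block_max//.
  apply: contraTle => lt; rewrite -ltNge (bigD1 p)//= [ltRHS](bigD1 p)//=.
  apply: ltr_leD; last first.
    by apply: ler_sum => q _; rewrite mxrowK; exact: mp_max (mp q) _ _ _.
  by apply: lt_le_trans lt _; rewrite mxrowK; exact: mp_max (mp p) _ _ _.
- move=> z z' /mxrowP e; apply/mxrowP => p; apply: (mp_inj (mp p)).
  by have := e p; rewrite !mxrowK.
Qed.

End Blocks.

(** * Existence of a rest point *)

Section Minty.
Context {R : realType} {n : nat} {Om : set 'rV[R]_n} {phi : 'rV[R]_n -> R}
  {c U : 'rV[R]_n -> 'rV[R]_n}.
Hypotheses (mp : mirror_pair Om phi c) (monoU : neg_monotone Om U).
Implicit Types x y z v w : 'rV[R]_n.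
Local Notation s := (conj_value phi c).

Definition simplex m :=
  [set l : 'rV[R]_m | (forall i, 0 <= l 0 i) /\ \sum_i l 0 i = 1].

Lemma simplex_compact m : compact (simplex m).
Proof.
apply: bounded_closed_compact.
  exists 1; split=> // M M1 l [l0 l1]; apply: le_trans (ltW M1).
  apply: normr_le_entries => // i; rewrite ger0_norm// -l1 (bigD1 i)//= lerDl.
  exact: sumr_ge0.
pose one : 'rV[R]_m := const_mx 1.
have sumE (l : 'rV[R]_m) : \sum_i l 0 i = dotv l one.
  by rewrite dotvE; apply: eq_bigr => i _; rewrite mxE mulr1.
rewrite (_ : simplex m =
    (\bigcap_(i in [set: 'I_m]) [set l : 'rV[R]_m | 0 <= l 0 i]) `&`
    [set l : 'rV[R]_m | dotv l one = 1]); last first.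
  apply/seteqP; split=> l [l0 l1].
    by split=> [i _|/=]; [exact: l0|rewrite -sumE].
  by split=> [i|]; [exact: l0|rewrite sumE].
apply: closedI.
  apply: closed_bigI => i _.
  apply: (preimage_closed _ (@closed_ge _ (0 : R))) => l _.
  exact: (@coord_continuous R 1 m 0 i).
apply: (preimage_closed _ (@closed_eq _ (1 : R))) => l _.
by apply: (cvg_dotv (FF := nbhs_filter l)); [exact: cvg_id|exact: cvg_cst].
Qed.

Lemma cvg_combination {T : Type} {F : set_system T} {FF : Filter F} m
    (v : 'I_m -> 'rV[R]_n) (f : T -> 'rV[R]_m) (l : 'rV[R]_m) :
  f @ F --> l -> \sum_i f t 0 i *: v i @[t --> F] --> \sum_i l 0 i *: v i.
Proof.
move=> fl; apply: cvg_big => [|i _].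
  by move=> [a b] /=; apply: add_continuous.
by apply: cvgZr_tmp; exact: cvg_comp fl (@coord_continuous R 1 m 0 i l).
Qed.

Lemma convex_combination m (l : 'I_m -> R) (y : 'I_m -> 'rV[R]_n) :
  (forall i, Om (y i)) -> (forall i, 0 <= l i) -> \sum_i l i = 1 ->
  Om (\sum_i l i *: y i) /\ phi (\sum_i l i *: y i) <= \sum_i l i * phi (y i).
Proof.
elim: m => [|m IHm] in l y * => Oy l0 l1.
  by move: l1; rewrite big_ord0 => /esym/eqP; rewrite oner_eq0.
rewrite !big_ord_recl; move: l1; rewrite big_ord_recl.
set L := \sum_(i < m) _ => lL.
have L0 : 0 <= L by apply: sumr_ge0.
have [LE|Lneq] := eqVneq L 0.
  have li0 i : l (lift ord0 i) = 0.
    move/eqP: LE; rewrite psumr_eq0// => /allP /(_ i (mem_index_enum _)).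
    by move=> /eqP.
  rewrite (_ : l ord0 = 1); last by rewrite -lL LE addr0.
  rewrite !big1 ?addr0 ?scale1r ?mul1r// => i _; first by rewrite li0 mul0r.
  by rewrite li0 scale0r.
have [//|i||Or phir] := IHm (fun i => L^-1 * l (lift ord0 i))
  (fun i => y (lift ord0 i)).
- by rewrite mulr_ge0// invr_ge0.
- by rewrite -mulr_sumr mulVf.
have lE : L = 1 - l ord0 by rewrite -lL addrC addKr.
have l01 : 0 <= l ord0 <= 1 by rewrite l0/=; lra.
have [] := mp_convex mp _ _ _ (Oy ord0) Or l01; rewrite -lE.
have -> : L *: (\sum_(i < m) (L^-1 * l (lift ord0 i)) *: y (lift ord0 i)) =
    \sum_(i < m) l (lift ord0 i) *: y (lift ord0 i).
  by rewrite scaler_sumr; apply: eq_bigr => i _; rewrite scalerA mulVKf.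
move=> Oc le; split=> //; apply: le_trans le _; rewrite lerD2l.
apply: le_trans (ler_wpM2l L0 phir) _; rewrite mulr_sumr.
by apply: ler_sum => i _; rewrite mulrA mulVKf.
Qed.

(** The inequalities say that phi lies below the affine functions
a_i(x) = b_i + <v_i, x> at x.  Mixtures of the a_i are indexed by the simplex;
take the one that minimizes l -> s(sum l_i v_i) + sum l_i b_i, the maximum of
the mixture minus phi, which is smooth in l.  The candidate is
x = c(sum l_i v_i).  Stationarity says that at x no a_i is below the optimal
mixture, so it suffices that phi does not exceed the mixture there; as x
maximizes the mixture minus phi, this need only be checked at the barycenter of
the y_i, where it follows from convexity of phi and monotonicity of -U. *)
Lemma finite_minty m (y : 'I_m.+1 -> 'rV[R]_n) : (forall i, Om (y i)) ->
  exists2 x, Om x & forall i, phi x <= phi (y i) + dotv (U (y i)) (x - y i).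
Proof.
move=> Oy; pose v i := U (y i); pose b i := phi (y i) - dotv (v i) (y i).
pose comb (l : 'rV[R]_m.+1) := \sum_i l 0 i *: v i.
pose bv : 'rV[R]_m.+1 := \row_i b i.
pose H l := s (comb l) + dotv l bv.
have contH : continuous H.
  move=> l; apply: (cvgD (FF := nbhs_filter l)).
    apply: (cvg_conj_value mp (FF := nbhs_filter l)).
    by apply: (cvg_combination (FF := nbhs_filter l)); exact: cvg_id.
  by apply: (cvg_dotv (FF := nbhs_filter l)); [exact: cvg_id|exact: cvg_cst].
have [|r|l [l0 l1] lmin] := compact_attains_min _ H (simplex_compact m.+1).
- exists (delta_mx 0 0); split=> [i|]; first by rewrite mxE; case: (_ && _).
  rewrite (bigD1 0)//= mxE big1 ?addr0// => i i0.
  by rewrite mxE (negbTE i0) andbF.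
- apply: closedI.
    exact: compact_closed (@norm_hausdorff _ _) (simplex_compact _).
  by apply: (preimage_closed _ (@closed_le _ r)) => l _; exact: contH.
pose w := comb l; pose bbar := dotv l bv.
(* first-order condition at l in the direction of the i-th vertex *)
have stationary i : bbar + dotv (c w) w <= b i + dotv (c w) (v i).
  pose wt t := t *: v i + (1 - t) *: w.
  have wt0 : c (wt t) @[t --> (0 : R)^'] --> c w.
    apply: (cvg_mirror mp (FF := dnbhs_filter (0 : R))).
    have -> : w = 0 *: v i + (1 - 0) *: w.
      by rewrite scale0r add0r subr0 scale1r.
    apply: cvgD; apply: cvgZr_tmp.
      by apply: cvg_within_filter; exact: cvg_id.
    by apply: cvgB; [exact: cvg_cst|apply: cvg_within_filter; exact: cvg_id].
  have lim : dotv (c (wt t)) (w - v i) @[t --> (0 : R)^'] -->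
      dotv (c w) (w - v i).
    by apply: cvg_dotv => //; exact: cvg_cst.
  suff : dotv (c w) (w - v i) <= b i - bbar by rewrite !dotv_lin; lra.
  apply: (dnbhs_limit_le _ _ _ 1 _ lim) => // t /andP[t0 t1].
  pose lt : 'rV[R]_m.+1 := t *: delta_mx 0 i + (1 - t) *: l.
  have := lmin lt; rewrite /H -/w -/bbar.
  have -> : comb lt = wt t.
    rewrite /comb /wt /w /comb scaler_sumr.
    rewrite (eq_bigr (fun j =>
      t *: ((j == i)%:R *: v j) + (1 - t) *: (l 0 j *: v j))).
      rewrite big_split /= -scaler_sumr (bigD1 i)//= eqxx scale1r big1 ?addr0//.
      by move=> j /negbTE ->; rewrite scale0r.
    by move=> j _; rewrite !mxE eqxx /= !scalerA -scalerDl.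
  rewrite /lt !dotv_lin (dotvC _ bv) dotv_delta mxE -/bbar.
  have /[swap] /[apply] : simplex m.+1 lt.
    split=> [j|].
      rewrite !mxE eqxx /= addr_ge0// mulr_ge0//; [exact: ltW|lra].
    rewrite (eq_bigr (fun j => t * (j == i)%:R + (1 - t) * l 0 j)).
      rewrite big_split /= -!mulr_sumr l1 (bigD1 i)//= eqxx.
      rewrite big1 => [|j /negbTE ->//].
      by rewrite !mulr1 addr0 mulr1 addrC subrK.
    by move=> j _; rewrite !mxE eqxx.
  have := conj_value_sub mp (wt t) w.
  rewrite (_ : w - wt t = t *: (w - v i)); last first.
    by apply/rowP => j; rewrite !mxE; ring.
  by rewrite !dotv_lin => h1 h2; rewrite -(ler_pM2l t0); lra.
exists (c w) => [|i]; first exact: mp_dom mp w.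
pose ybar := \sum_j l 0 j *: y j.
have [Oyb jensen] := convex_combination _ _ _ Oy l0 l1.
have bbarE : bbar = \sum_j l 0 j * (phi (y j) - dotv (v j) (y j)).
  by rewrite /bbar dotvE; apply: eq_bigr => j _; rewrite mxE.
(* at the barycenter, replacing U (y j) by U ybar only lowers the mixture *)
have ybar_le : phi ybar <= bbar + dotv ybar w.
  apply: le_trans jensen _; rewrite bbarE dotv_sumr -big_split /=.
  rewrite -subr_ge0 -sumrB.
  have zero : 0 = \sum_j l 0 j * dotv (U ybar) (ybar - y j).
    rewrite -dotv_sumr.
    rewrite (eq_bigr (fun j => l 0 j *: ybar - l 0 j *: y j)).
      by rewrite sumrB -scaler_suml l1 scale1r subrr dotvC /dotv mul0mx mxE.
    by move=> j _; rewrite scalerBr.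
  rewrite [leLHS]zero; apply: ler_sum => j _.
  have := ler_wpM2l (l0 j) (monoU _ _ (Oy j) Oyb).
  by rewrite -/(v j) mulr0 (dotvC ybar) !dotv_lin; lra.
have := mp_max mp w _ Oyb; have := stationary i.
by move: ybar_le; rewrite /b /v !dotv_lin (dotvC (c w) (U _)); lra.
Qed.

(** The point y0 is added to every finite family of test points: it makes the family
nonempty and confines the solutions to a compact set. *)
Lemma minty : exists2 x, Om x &
  forall y, Om y -> phi x <= phi y + dotv (U y) (x - y).
Proof.
pose S y := [set x | Om x /\ phi x <= dotv (U y) x + (phi y - dotv (U y) y)].
have SE x y : S y x <-> Om x /\ phi x <= phi y + dotv (U y) (x - y).
  by rewrite /S /= !dotv_lin; split=> -[Ox h]; split=> //; lra.
have cS y : compact (S y) by exact: (mp_sublevel_compact mp).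
have clS y : closed (S y) by exact: compact_closed (@norm_hausdorff _ _) (cS y).
pose y0 := c 0.
have Oy0 : Om y0 by exact: (mp_dom mp).
have := cS y0; rewrite compact_In0 => /(_ _ Om (fun y => S y0 `&` S y)) [].
- by exists S.
- move=> D DO; pose ys := y0 :: finmap.enum_fset D.
  have Oys (i : 'I_(size (finmap.enum_fset D)).+1) : Om (nth 0 ys i).
    have /predU1P[->//|iD] : nth 0 ys i \in ys by exact: mem_nth.
    exact/set_mem/DO.
  have [x Ox xmin] := finite_minty _ _ Oys.
  have xS y : y \in ys -> S y x.
    move=> yys; apply/SE; split=> //.
    have iys : (index y ys < (size (finmap.enum_fset D)).+1)%N.
      by rewrite index_mem.
    by have := xmin (Ordinal iys); rewrite /= nth_index.
  exists x => y /= yD; split; apply: xS; first by rewrite inE eqxx.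
  by rewrite inE [X in _ || X]yD orbT.
- move=> x xS; exists x; first by have [[]] := xS y0 Oy0.
  by move=> y Oy; have [_ /SE[]] := xS y Oy.
Qed.

(** Testing at w = t y + (1 - t) x, dividing by t and letting t tend to 0 turns the
test value U w into U x.  The inequality then says that x maximizes
<., U x> - phi, that is x = c (U x), and U x is a rest point. *)
Lemma rest_point_exists :
  {within Om, continuous U} -> exists z, z = U (c z).
Proof.
move=> contU; have [x Ox xmin] := minty.
suff VI y : Om y -> phi x + dotv (U x) (y - x) <= phi y.
  exists (U x); rewrite -(mp_uniq mp (U x) x)// => y Oy.
  by have := VI y Oy; rewrite (dotvC y) (dotvC x) !dotv_lin; lra.
move=> Oy; rewrite leNgt; apply/negP => gap.
pose g := phi x + dotv (U x) (y - x) - phi y.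
have g0 : 0 < g by rewrite /g; lra.
pose K : R := n%:R * `|y - x| + 1.
have K0 : 0 < K by rewrite ltr_wpDl// mulr_ge0.
have [d d0 hd] : exists2 d : R, 0 < d &
    forall w, Om w -> `|w - x| < d -> `|U w - U x| < g / K.
  by apply: within_continuous_dist => //; exact: divr_gt0.
pose t := Num.min 1 (d / (`|y - x| + 1) / 2).
have yx1 : 0 < `|y - x| + 1 by rewrite ltr_wpDl.
have dq0 : 0 < d / (`|y - x| + 1) by exact: divr_gt0.
have t0 : 0 < t by rewrite lt_min ltr01 divr_gt0.
have t1 : t <= 1 by rewrite ge_min lexx.
have td : t < d / (`|y - x| + 1).
  apply: (@le_lt_trans _ _ (d / (`|y - x| + 1) / 2)); last lra.
  by rewrite ge_min lexx orbT.
have t01 : 0 <= t <= 1 by rewrite (ltW t0).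
pose w := t *: y + (1 - t) *: x.
have [Ow phiw] := mp_convex mp _ _ _ Oy Ox t01.
have wx : w - x = t *: (y - x) by apply/rowP => i; rewrite !mxE; ring.
have wd : `|w - x| < d.
  rewrite wx normrZ gtr0_norm//; move: td; rewrite ltr_pdivlMr//.
  by apply: le_lt_trans; rewrite ler_pM2l// lerDl.
have := hd w Ow wd; rewrite ltr_pdivlMr// => Uw.
have := normr_dotv (U w - U x) (y - x); rewrite ler_norml => /andP[lo _].
have := xmin w Ow; rewrite -[x - w]opprB wx dotvNr dotvZr => h.
have {}h : phi x + dotv (U w) (y - x) <= phi y.
  by rewrite -(ler_pM2l t0); lra.
have un : n%:R * (`|U w - U x| * `|y - x|) < g.
  apply: le_lt_trans Uw; rewrite /K mulrDr mulr1 mulrCA lerDl//.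
move: lo un h; rewrite /g !dotv_lin; lra.
Qed.

End Minty.

(** * Convergence of the dynamics *)

(** The weight 1 + g t grows slower than the integrating factor exp(g t), so
that the product with V is still nonincreasing; it is enough to send V to 0. *)
Lemma differential_decay {R : realType} (V dV : R -> R) (g : R) :
  0 < g -> {within `[0, +oo[, continuous V} ->
  (forall t : R, 0 < t -> is_derive t 1 V (dV t)) ->
  (forall t : R, 0 < t -> dV t <= - (g * V t)) ->
  (forall t : R, 0 <= V t) ->
  V t @[t --> +oo] --> 0.
Proof.
move=> g0 cV dVt dVle V0.
pose a (t : R) := 1 + g * t; pose W (t : R) := a t * V t.
have da (t : R) : is_derive t 1 a g.
  by apply: is_derive_eq; rewrite add0r mul1r /GRing.scale /= mulr1.
have dW (t : R) : 0 < t -> is_derive t 1 W (a t * dV t + V t * g).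
  by move=> t0; have dt := dVt t t0; exact: is_deriveM.
have ca : continuous a.
  by move=> t; exact/differentiable_continuous/derivable1_diffP.
have W_le (t : R) : 0 <= t -> W t <= W 0.
  move=> t0; apply: (@ler0_derive1_nincry _ W 0) => //.
  - by move=> x; rewrite in_itv/= andbT => /dW[].
  - move=> x; rewrite in_itv/= andbT => x0; have [_] := dW x x0.
    rewrite derive1E => ->; have gx : 0 <= g * x by rewrite mulr_ge0 ?ltW.
    have := mulr_ge0 gx (mulr_ge0 (ltW g0) (V0 x)).
    have ax : 0 <= a x by rewrite /a; lra.
    by have := ler_wpM2l ax (dVle x x0); rewrite /a; lra.
  - apply/subspace_continuousP => x x0; apply: cvgM.
      by apply: cvg_within_filter; exact: ca.
    by move/subspace_continuousP : cV; exact.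
apply/cvgrPdist_lt => e e0; near=> t.
have t0 : 0 <= t by [].
rewrite sub0r normrN ger0_norm//.
have := W_le t t0; rewrite /W /a mulr0 addr0 mul1r => h.
have te : V 0 / (g * e) < t by near: t; apply: nbhs_pinfty_gt; rewrite num_real.
rewrite ltr_pdivrMr ?mulr_gt0// in te.
have gt0 : 0 <= g * t by rewrite mulr_ge0// ltW.
rewrite ltNge; apply/negP => eV.
have : g * t * e <= g * t * V t by rewrite ler_wpM2l.
have := V0 t; nra.
Unshelve. all: by end_near. Qed.

Lemma is_derive_dotv {R : realType} {n : nat} (a v : 'rV[R]_n)
    (z : R -> 'rV[R]_n) (t : R) :
  is_derive t 1 z v -> is_derive t 1 (fun t => dotv a (z t)) (dotv a v).
Proof.
move=> dz; suff h :
    (fun h => h^-1 *: (dotv a (z (h *: 1 + t)) - dotv a (z t))) @ 0^' -->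
    dotv a v by split; [exact: cvgP h|exact: cvg_lim h].
have qv : h^-1 *: (z (h *: 1 + t) - z t) @[h --> (0 : R)^'] --> v.
  by case: dz => dz <-; exact: dz.
rewrite (_ : (fun _ => _) = fun h => dotv a (h^-1 *: (z (h *: 1 + t) - z t))).
  by apply: cvg_dotv => //; exact: cvg_cst.
by apply/funext => h; rewrite !dotv_lin.
Qed.

(** The Fenchel gap to the rest point decays: its derivative is
<x - xb, g (-z + U x)>, where -z + U x = (zb - z) + (U x - U xb). *)
Lemma discounted_flow_cvg {R : realType} {n : nat} (Om : set 'rV[R]_n)
    (phi : 'rV[R]_n -> R) (c U : 'rV[R]_n -> 'rV[R]_n) (g : R)
    (z : R -> 'rV[R]_n) (zb : 'rV[R]_n) :
  mirror_pair Om phi c -> neg_monotone Om U -> 0 < g -> zb = U (c zb) ->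
  {within `[0, +oo[, continuous z} ->
  (forall t : R, 0 < t -> is_derive t 1 z (g *: (- z t + U (c (z t))))) ->
  z t @[t --> +oo] --> zb.
Proof.
move=> mp monoU g0 rest cz dz; apply: (dual_gap_cvg mp).
set s := conj_value phi c; pose v t := g *: (- z t + U (c (z t))).
pose V t := (phi (c zb) + s (z t)) - dotv (c zb) (z t).
apply: (@differential_decay _ V
  (fun t => dotv (c (z t)) (v t) - dotv (c zb) (v t)) g) => //.
- apply/subspace_continuousP => x x0.
  have FF : Filter (within `[0, +oo[ (nbhs (x : R))).
    exact: within_filter (nbhs_filter x).
  have cx : z y @[y --> within `[0, +oo[ (nbhs (x : R))] --> z x.
    by move/subspace_continuousP : cz; exact.
  apply: (cvgB (FF := FF)).
    apply: (cvgD (FF := FF)); first exact: cvg_cst.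
    exact: (cvg_conj_value mp (FF := FF)).
  by apply: (cvg_dotv (FF := FF)) => //; exact: cvg_cst.
- move=> t t0; have dzt := dz t t0.
  have ds := is_derive_conj_value mp _ _ _ dzt.
  have dd := is_derive_dotv (c zb) _ _ _ dzt.
  have := is_deriveB (is_deriveD (is_derive_cst (phi (c zb)) t 1) ds) dd.
  by rewrite add0r.
- move=> t t0.
  have mono := monoU _ _ (mp_dom mp (z t)) (mp_dom mp zb).
  rewrite -rest in mono.
  have := conj_value_sub mp (z t) zb.
  rewrite /V /v !dotvZr -mulrBr -mulrN ler_pM2l//.
  have -> : phi (c zb) = dotv (c zb) zb - s zb by rewrite /s /conj_value; ring.
  move: mono; rewrite -/s !dotv_lin !(dotvC _ (c _)); lra.
- move=> t; have := conj_value_sub mp zb (z t).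
  by rewrite /V /s /conj_value !dotv_lin; lra.
Qed.

(** * Perturbed Nash equilibria *)

Lemma norm2Z {R : realType} {n : nat} (t : R) (v : 'rV[R]_n) :
  0 <= t -> norm2 (t *: v) = t * norm2 v.
Proof.
move=> t0; rewrite /norm2 dotvZl dotvZr mulrA sqrtrM ?mulr_ge0//.
by rewrite -expr2 sqrtr_sqr ger0_norm.
Qed.

Lemma norm2_gt0 {R : realType} {n : nat} (v : 'rV[R]_n) : v != 0 -> 0 < norm2 v.
Proof.
move=> v0; rewrite /norm2 sqrtr_gt0 dotvE lt0r sumr_ge0 => [|i _]; last first.
  exact: sqr_ge0.
rewrite andbT; apply: contra_neq v0 => sum0; apply/rowP => i; rewrite mxE.
move/eqP : sum0; rewrite psumr_eq0 => [|j _]; last exact: sqr_ge0.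
by move=> /allP /(_ i (mem_index_enum _)); rewrite /= mulf_eq0 orbb => /eqP.
Qed.

(** The gradient is only known through its expansion along A.  If the inequality
failed, concavity would keep the relative error of the expansion bounded below
along the segment from x to y, which stays in A. *)
Lemma concave_first_order {R : realType} {n : nat} (A : set 'rV[R]_n)
    (h : 'rV[R]_n -> R) (x y v : 'rV[R]_n) :
  convex_set A -> convex_function A (fun y => - h y) ->
  is_gradient_on A h x v ->
  A x -> A y -> h y - h x <= dotv v (y - x).
Proof.
move=> cA ch grad Ax Ay; have [->|yx] := eqVneq y x.
  by rewrite !subrr dotvC /dotv mul0mx mxE.
rewrite leNgt; apply/negP => gap.
have N0 : 0 < norm2 (y - x) by apply: norm2_gt0; rewrite subr_eq0.
pose e := (h y - h x - dotv v (y - x)) / norm2 (y - x).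
have e0 : 0 < e by rewrite divr_gt0// subr_gt0.
move/cvgrPdist_lt : grad => /(_ e e0) /nbhs_ballP[d /= d0 hd].
pose t := Num.min 1 (d / `|y - x| / 2).
have yx0 : 0 < `|y - x| by rewrite normr_gt0 subr_eq0.
have dq0 : 0 < d / `|y - x| by exact: divr_gt0.
have t0 : 0 < t by rewrite lt_min ltr01 divr_gt0.
have t1 : t <= 1 by rewrite ge_min lexx.
have td : t < d / `|y - x|.
  apply: (@le_lt_trans _ _ (d / `|y - x| / 2)); last lra.
  by rewrite ge_min lexx orbT.
pose w := t *: y + (1 - t) *: x.
have wx : w - x = t *: (y - x) by apply/rowP => i; rewrite !mxE; ring.
have Aw : A w.
  have := cA y x (Itv01 (ltW t0) t1) (mem_set Ay) (mem_set Ax).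
  by move/set_mem.
have hw : t * (h y - h x) <= h w - h x.
  have := ch (Itv01 (ltW t0) t1) y x (mem_set Ay) (mem_set Ax).
  rewrite -[X in X <= _ -> _]/(- h w).
  rewrite -[X in _ <= X -> _]/(t * - h y + (1 - t) * - h x).
  lra.
have := hd w; rewrite -ball_normE /= distrC wx normrZ gtr0_norm// -ltr_pdivlMr//.
move=> /(_ td) /(_ _ Aw).
rewrite -subr_eq0 wx scaler_eq0 negb_or gt_eqF//= subr_eq0 => /(_ yx).
rewrite sub0r normrN norm2Z ?(ltW t0)// dotvZr ltNge => /negP; apply.
apply: le_trans (ler_norm _).
rewrite /e ler_pdivlMr ?mulr_gt0// mulrCA divfK ?gt_eqF//.
lra.
Qed.

Section Game.
Context {R : realType} (G : game R)
  (theta : forall p : 'I_(nplayers G), 'rV[R]_(@ndim R G p) -> \bar R)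
  (eps : R).

Lemma block_deviate (x : profile G) p (y : 'rV[R]_(ndim p)) q :
  block (deviate x y) q = dfwith (block x) p y q.
Proof. by rewrite /block mxrowK. Qed.

Lemma deviate_block (x : profile G) p : deviate x (block x p) = x.
Proof.
apply/mxrowP => q; rewrite -/(block (deviate x (block x p)) q) block_deviate.
by case: dfwithP.
Qed.

Hypotheses (hG : concave_game G)
  (htheta : forall p,
     [/\ closed_fun (theta p), proper_fun (theta p) & convex_fun (theta p)])
  (hdom : forall p, dom (theta p) = actions G p)
  (hint : forall p, interior (dom (theta p)) !=set0)
  (hleg : forall p, legendre (theta p)) (heps : 0 < eps)
  (hconj : forall p, dom (conjugate (regularizer G eps theta p)) = setT).

Local Notation phi p := (fun y => eps * fine (theta p y)).

Lemma player_mirror_pair p :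
  mirror_pair (actions G p) (phi p)
    (fun zp => xget 0 (argmax_set eps theta (p := p) zp)).
Proof.
have [closedf properf convexf] := htheta p.
have [[_ closed_act _] _] := hG p.
rewrite -hdom; apply: legendre_mirror_pair => //; first by rewrite hdom.
by move=> zp; rewrite /ereal_argmax hdom.
Qed.

Lemma game_mirror_pair :
  mirror_pair (joint_actions G) (fun x => \sum_p phi p (block x p))
    (mirror_map G eps theta).
Proof. exact: joint_mirror_pair player_mirror_pair. Qed.

(** Block p of zb is the gradient of the payoff of player p and, by optimality of
the mirror map, a subgradient of the regularizer at the same point. *)
Lemma rest_point_perturbed_nash zb : rest_point G eps theta zb ->
  perturbed_nash G eps theta (mirror_map G eps theta zb).
Proof.
move=> rest; have Ox := mp_dom game_mirror_pair zb.
set x := mirror_map _ _ _ _ in Ox *; split=> // p y Oy.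
have [_ properf _] := htheta p.
have [[_ _ convA] [_ conc cdiff]] := hG p.
have fin w : actions G p w -> (eps%:E * theta p w)%E = (phi p w)%:E.
  by rewrite -hdom => fw; rewrite (dom_fineK _ properf _ fw).
rewrite /perturbed_payoff block_deviate dfwithin !fin//.
rewrite -!EFinB lee_fin.
have zbE : block zb p = gradient_on (actions G p)
    (fun y => payoff G p (deviate x y)) (block x p).
  by rewrite [in LHS]rest /block mxrowK.
have [v gradv] := (cdiff x Ox).1 _ (Ox p).
have grad : is_gradient_on (actions G p) (fun y => payoff G p (deviate x y))
    (block x p) (block zb p).
  by rewrite zbE; apply: (xgetPex 0); exists v.
have := concave_first_order _ _ _ _ _ convA (conc x Ox) grad (Ox p) Oy.
rewrite deviate_block.
have := mp_max (player_mirror_pair p) (block zb p) y Oy.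
rewrite (_ : xget 0 _ = block x p); last by rewrite /x /block mxrowK.
rewrite (dotvC (block zb p)) !dotv_lin; lra.
Qed.

End Game.

(** * The convergence theorem *)

Theorem theorem2 (R : realType) (G : game R)
  (theta : forall p : 'I_(nplayers G), 'rV[R]_(@ndim R G p) -> \bar R)
  (eps gamma : R)
  (hG : concave_game G)
  (hU : {within joint_actions G, continuous (pseudo_gradient G)})
  (hcoer : forall p, ~ compact (actions G p) -> coercive_payoff G p)
  (htheta : forall p,
     [/\ closed_fun (theta p), proper_fun (theta p) & convex_fun (theta p)])
  (hdom : forall p, dom (theta p) = actions G p)
  (hint : forall p, interior (dom (theta p)) !=set0)
  (hleg : forall p, legendre (theta p))
  (heps : 0 < eps) (hgamma : 0 < gamma)
  (hconj : forall p, dom (conjugate (regularizer G eps theta p)) = setT)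
  (hfin : finite_set (rest_point G eps theta))
  (hiso : forall w, rest_point G eps theta w ->
            isolated (rest_point G eps theta) w)
  (hmono :
     [\/ neg_monotone (joint_actions G) (pseudo_gradient G),
         neg_strictly_monotone (joint_actions G) (pseudo_gradient G) |
         exists2 eta : R, 0 < eta &
           neg_strongly_monotone eta (joint_actions G) (pseudo_gradient G)])
  (z x u : R -> 'rV[R]_(\sum_p @ndim R G p))
  (hz : DMD G eps theta gamma z x u) :
  exists zbar : 'rV[R]_(\sum_p @ndim R G p),
    [/\ rest_point G eps theta zbar,
        z t @[t --> +oo] --> zbar,
        x t @[t --> +oo] --> mirror_map G eps theta zbar &
        perturbed_nash G eps theta (mirror_map G eps theta zbar)].
Proof.
have mp : mirror_pair (joint_actions G)
    (fun x => \sum_p eps * fine (theta p (block x p))) (mirror_map G eps theta).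
  exact: game_mirror_pair.
have monoU : neg_monotone (joint_actions G) (pseudo_gradient G).
  move=> w w' Ow Ow'; case: hmono => [|mono|[eta eta0 mono]]; first exact.
    have [->|ww'] := eqVneq w w'; last exact/ltW/mono.
    by rewrite !subrr /dotv mul0mx mxE oppr0.
  by apply: le_trans (mono w w' Ow Ow'); rewrite mulr_ge0 ?sqr_ge0// ltW.
have [zb rest] := rest_point_exists mp monoU hU.
case: hz => cz [dz xE uE].
have zcvg : z t @[t --> +oo] --> zb.
  apply: (discounted_flow_cvg _ _ _ _ _ _ _ mp monoU hgamma rest cz) => t t0.
  by rewrite -xE ?ltW// -uE ?ltW//; exact: dz.
exists zb; split=> //; last first.
  exact: rest_point_perturbed_nash.
apply: cvg_trans (cvg_mirror mp _ _ zcvg); apply: near_eq_cvg.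
by near=> t; rewrite xE.
Unshelve. all: by end_near. Qed.
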